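(* Let $F=\{f_1<\cdots<f_k\}$ be a finite set of positive integers. Then $F$ is admissible if and only if the Wronskian determinant $$\Omega_F(x)=\det\big(H_{f_i}^{(j-1)}(x)\big)_{i,j=1}^k$$ does not vanish in $\mathbb{R}$.
   Context: Hermite polynomials: $H_n(x)=n!\sum_{j=0}^{[n/2]}\frac{(-1)^j(2x)^{n-2j}}{j!(n-2j)!}$. Admissible: write $F=\bigcup_{i=1}^KY_i$ as a disjoint union where the elements of each $Y_i$ are consecutive integers and $1+\max Y_i<\min Y_{i+1}$ for $i=1,\dots,K-1$. $F$ is admissible if every $Y_i$ has an even number of elements. *)

(* Defs.v *)
From mathcomp Require Import all_boot all_order all_algebra.
From mathcomp Require Import finmap reals.

Set Implicit Arguments.
Unset Strict Implicit.
Unset Printing Implicit Defensive.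

Import Order.TTheory GRing.Theory Num.Theory.

Local Open Scope fset_scope.

(* [f_1; ...; f_k] for F = {f_1 < ... < f_k} *)
Definition increnum (F : {fset nat}) : seq nat := sort leq (enum_fset F).

(* Both are 0 on the empty set; they are only used on nonempty sets. *)
Definition fmin (Y : {fset nat}) : nat := head 0%N (increnum Y).
Definition fmax (Y : {fset nat}) : nat := last 0%N (increnum Y).

Definition consecutive (Y : {fset nat}) : bool :=
  increnum Y == iota (fmin Y) #|` Y|.

(* K = size Ys may be 0, which happens exactly when F is empty.  Nonemptiness
   of the blocks is implicit in the use of their minimum and maximum. *)
Definition block_decomposition (F : {fset nat}) (Ys : seq {fset nat}) : Prop :=
  [/\ F = \bigcup_(Y <- Ys) Y,
      pairwise (fun Y Z => [disjoint Y & Z]) Ys,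
      all (fun Y => (Y != fset0) && consecutive Y) Ys &
      sorted (fun Y Z => (1 + fmax Y < fmin Z)%N) Ys].

(* Such a decomposition exists and is unique: the blocks are the maximal runs
   of consecutive elements of F. *)
Definition admissible (F : {fset nat}) : Prop :=
  exists Ys : seq {fset nat},
    block_decomposition F Ys /\ all (fun Y => ~~ odd #|` Y|) Ys.

Local Open Scope ring_scope.

Definition hermite (R : realType) (n : nat) : {poly R} :=
  n`!%:R *: \sum_(j < n./2.+1)
    ((-1) ^+ j / (j`!%:R * (n - 2 * j)`!%:R)) *: (2%:R *: 'X) ^+ (n - 2 * j).

(* Columns are indexed from 0, so column j carries the j-th derivative. *)
Definition wronskian_hermite (R : realType) (F : {fset nat}) (x : R) : R :=
  \det (\matrix_(i < #|` F|, j < #|` F|)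
          (hermite R (nth 0%N (increnum F) i))^`(j).[x]).

(* Main.v *)
(* For a list s write W(s) for the Wronskian of the H_f, f in s.  The quotients
   W(s,n)/W(s) are the iterated Darboux transforms of the H_n, which yields
     (exp(-x^2) W(s,n,m)/W(s))' = 2(n - m) exp(-x^2) W(s,n) W(s,m)/W(s)^2
   and, up to the derivative of a rational multiple of exp(-x^2),
     exp(-x^2) (W(s,n)/W(s))^2 = 2^k prod_(f in s) (n - f) exp(-x^2) H_n^2.
   If W(s) has no real zero, the second identity forces prod_(f in s) (n - f)
   to be nonnegative for all n, which characterizes admissibility when 0 is not
   in s.

   Conversely let s be admissible.  By Christoffel's formula and the self-duality
   of the Krawtchouk polynomials, the Casoratians of the Krawtchouk polynomials
   indexed by s have constant sign, because prod_(f in s) (x - f) times the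
   binomial weight is a nonnegative measure on {0, ..., N}; letting N tend to
   infinity, W(s) >= 0.  Now s = (t, n, n + 1) with t admissible, and W(t) has no
   zero by induction.  At a zero x of W(s) of order e, the first identity says
   that the orders of W(t,n) and W(t,n+1) add up to e - 1, and Jacobi's identity
   W(t) W(s) = W(t,n) W(t,n+1)' - W(t,n)' W(t,n+1) then says that they are equal;
   so e is odd and W(s) changes sign, a contradiction. *)

Require Import Defs.
From HB Require Import structures.
From mathcomp Require Import all_boot all_order all_algebra.
From mathcomp Require Import finmap reals.
From mathcomp Require Import polyrcf ring lra zify.

Set Implicit Arguments.
Unset Strict Implicit.
Unset Printing Implicit Defensive.

Import Order.TTheory GRing.Theory Num.Theory.

Local Open Scope ring_scope.

(** * Determinants and Wronskians *)

Definition natdet (S : comNzRingType) (k : nat) (a : nat -> nat -> S) : S :=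
  \det (\matrix_(i < k, j < k) a i j).

Lemma eq_natdet (S : comNzRingType) (k : nat) (a b : nat -> nat -> S) :
  (forall i j, (i < k)%N -> (j < k)%N -> a i j = b i j) ->
  natdet k a = natdet k b.
Proof. by move=> ab; congr (\det _); apply/matrixP=> i j; rewrite !mxE ab. Qed.

Lemma natdet0 (S : comNzRingType) (a : nat -> nat -> S) : natdet 0 a = 1.
Proof. exact: det_mx00. Qed.

Lemma natdet_block (S : comNzRingType) (k m : nat) (a : nat -> nat -> S) :
  natdet (k + m) a =
  \det (block_mx (\matrix_(i < k, j < k) a i j)
                 (\matrix_(i < k, j < m) a i (k + j)%N)
                 (\matrix_(i < m, j < k) a (k + i)%N j)
                 (\matrix_(i < m, j < m) a (k + i)%N (k + j)%N)).
Proof.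
congr (\det _); apply/matrixP => i j.
by rewrite !mxE; case: splitP => i' ->; rewrite !mxE; case: splitP => j' ->;
   rewrite !mxE.
Qed.

(** Right multiplication by the unipotent block matrix with corner [- T^-1 U] clears the upper right
    block. *)
Lemma det_schur (K : fieldType) (k m : nat) (T : 'M[K]_k) U V (Z : 'M[K]_m) :
  T \in unitmx ->
  \det (block_mx T U V Z) = \det T * \det (Z - V *m invmx T *m U).
Proof.
move=> Tu; rewrite -(det_lblock _ V) -[LHS]mulr1.
have <- : \det (block_mx 1%:M (- (invmx T *m U)) 0 1%:M) = 1 :> K.
  by rewrite det_ublock !det1 mulr1.
rewrite -det_mulmx mulmx_block !mulmx1 !mulmx0 !addr0.
by rewrite !mulmxN mulKVmx // addNr mulmxA addrC.
Qed.

(** Read on indices up to [k]: the leading block of order [k] bordered by row [r] and column [c]. *)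
Definition border (S : Type) (k r c : nat) (a : nat -> nat -> S) (i j : nat) : S :=
  a (if (i < k)%N then i else r) (if (j < k)%N then j else c).

(** [s] is the Schur complement of the leading block, taken for all rows and columns at once: minors
    containing that block are its determinant times minors of [s]. *)
Lemma natdet_schur (K : fieldType) (k : nat) (a : nat -> nat -> K) :
  natdet k a != 0 -> exists s : nat -> nat -> K,
    (forall r c, natdet k.+1 (border k r c a) = natdet k a * s r c) /\
    natdet k.+2 a =
      natdet k a * (s k k * s k.+1 k.+1 - s k k.+1 * s k.+1 k).
Proof.
move=> d0; pose T := \matrix_(i < k, j < k) a i j.
have Tu : T \in unitmx by rewrite unitmxE unitfE.
pose s r c := a r c -
  ((\row_(j < k) a r j) *m invmx T *m (\col_(i < k) a i c)) 0 0.
(* One formula for any number [m] of added rows [r] and columns [c]; it is applied with [m = 1] and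
   [m = 2]. *)
have sE m (b : nat -> nat -> K) (r c : 'I_m -> nat) :
    (forall i j, (i < k)%N -> (j < k)%N -> b i j = a i j) ->
    (forall (i : 'I_m) j, (j < k)%N -> b (k + i)%N j = a (r i) j) ->
    (forall i (j : 'I_m), (i < k)%N -> b i (k + j)%N = a i (c j)) ->
    (forall i j : 'I_m, b (k + i)%N (k + j)%N = a (r i) (c j)) ->
  natdet (k + m) b =
  natdet k a * \det (\matrix_(i < m, j < m) s (r i) (c j)).
  move=> h1 h2 h3 h4; rewrite natdet_block.
  have -> : \matrix_(i < k, j < k) b i j = T.
    by apply/matrixP=> i j; rewrite !mxE h1.
  rewrite det_schur //; congr (_ * \det _); apply/matrixP=> i j.
  rewrite !mxE /s !mxE h4; congr (_ - _).
  by apply: eq_bigr => l _; rewrite !mxE h3 //; congr (_ * _);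
     apply: eq_bigr => l' _; rewrite !mxE h2.
exists s; split.
  move=> r c; rewrite -addn1 (@sE 1%N _ (fun=> r) (fun=> c)) ?det_mx11 ?mxE //.
  - by move=> i j ik jk; rewrite /border ik jk.
  - by move=> i j jk; rewrite /border jk ltnNge leq_addr.
  - by move=> i j jk; rewrite /border jk ltnNge leq_addr.
  - by move=> i j; rewrite /border !ltnNge !leq_addr.
rewrite -addn2 (@sE 2%N _ (fun i => (k + i)%N) (fun i => (k + i)%N)) //.
congr (_ * _); rewrite (expand_det_row _ 0) !big_ord_recl big_ord0.
rewrite /cofactor !det_mx11 !mxE /= /bump /= !addn0 !addn1 /=.
by rewrite !expr0 expr1 /=; ring.
Qed.

(* Desnanot-Jacobi *)
Lemma natdet_desnanot (S : idomainType) (k : nat) (a : nat -> nat -> S) :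
  natdet k a != 0 ->
  natdet k a * natdet k.+2 a =
  natdet k.+1 (border k k k a) * natdet k.+1 (border k k.+1 k.+1 a) -
  natdet k.+1 (border k k k.+1 a) * natdet k.+1 (border k k.+1 k a).
Proof.
(* The Schur complement needs an inverse, so the entries are read in the fraction field. *)
pose b i j := tofrac (a i j).
have E m (c : nat -> nat -> S) : natdet m (fun i j => tofrac (c i j)) = tofrac (natdet m c).
  have := det_map_mx (@tofrac S) (\matrix_(i < m, j < m) c i j).
  by move<-; congr (\det _); apply/matrixP=> i j; rewrite !mxE.
have bE r c : natdet k.+1 (border k r c b) = tofrac (natdet k.+1 (border k r c a)).
  by rewrite -E.
move=> d0; have d0' : natdet k b != 0 by rewrite E tofrac_eq0.
have [s [s1 s2]] := natdet_schur d0'.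
apply/eqP; rewrite -tofrac_eq; apply/eqP; rewrite tofracB !tofracM -!bE -!E -/b s2 !s1; ring.
Qed.

Lemma deriv_prod (R : comNzRingType) (n : nat) (F : 'I_n -> {poly R}) :
  (\prod_(i < n) F i)^`() =
  \sum_(j < n) \prod_(i < n) (if i == j then (F i)^`() else F i).
Proof.
elim: n F => [|n IH] F; first by rewrite !big_ord0 derivC.
rewrite big_ord_recl derivM IH big_ord_recl; congr (_ + _).
  by rewrite big_ord_recl eqxx; congr (_ * _); apply: eq_bigr => i _.
rewrite mulr_sumr; apply: eq_bigr => j _; rewrite big_ord_recl /=.
by congr (_ * _); apply: eq_bigr => i _.
Qed.

Lemma deriv_det (R : comNzRingType) (n : nat) (A : 'M[{poly R}]_n) :
  (\det A)^`() =
  \sum_(l < n) \det (\matrix_(i, j) (if i == l then (A i j)^`() else A i j)).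
Proof.
rewrite /determinant raddf_sum exchange_big /=; apply: eq_bigr => s _.
have -> (b : bool) (p : {poly R}) : ((-1) ^+ b * p)^`() = (-1) ^+ b * p^`().
  by case: b; rewrite ?expr0 ?mul1r // expr1 !mulN1r derivN.
rewrite -mulr_sumr deriv_prod; congr (_ * _).
by apply: eq_bigr => l _; apply: eq_bigr => i _; rewrite mxE.
Qed.

Definition wronskian (R : comNzRingType) (s : seq {poly R}) : {poly R} :=
  natdet (size s) (fun i j => (s`_i)^`(j)).

(** Differentiating column [l < k] produces a copy of column [l + 1], so only the derivative of the
    last column contributes. *)
Lemma deriv_wronskian (R : comNzRingType) (k : nat) (p : nat -> {poly R}) :
  (natdet k.+1 (fun i j => (p i)^`(j)))^`() =
  natdet k.+1 (fun i j => (p i)^`(if (j < k)%N then j else k.+1)).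
Proof.
rewrite /natdet -det_tr deriv_det big_ord_recr /= big1 ?add0r => [|l _].
  rewrite -det_tr; congr (\det _); apply/matrixP=> i j; rewrite !mxE.
  case: (ltnP j k) => jk; last first.
    have -> : j = ord_max by apply/val_inj/eqP; rewrite /= eqn_leq jk -ltnS ltn_ord.
    by rewrite eqxx -derivnS.
  by case: eqP => // jE; move: jk; rewrite jE ltnn.
have lk := ltn_ord l.
apply: (@determinant_alternate _ _ _ (widen_ord (leqnSn k) l) (lift ord0 l)).
  by rewrite -val_eqE /= /bump /= add1n neq_ltn ltnSn.
move=> j; rewrite !mxE eqxx -val_eqE /= /bump /= add1n -derivnS.
by rewrite gtn_eqF.
Qed.

(** Desnanot-Jacobi for the derivatives of [s], [g], [h]: by [deriv_wronskian], the bordered minors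
    that use the last column are derivatives of Wronskians. *)
Lemma wronskian_jacobi (R : idomainType) (s : seq {poly R}) (g h : {poly R}) :
  wronskian s != 0 ->
  wronskian s * wronskian (rcons (rcons s g) h) =
  wronskian (rcons s g) * (wronskian (rcons s h))^`() -
  (wronskian (rcons s g))^`() * wronskian (rcons s h).
Proof.
pose k := size s; pose t := rcons (rcons s g) h.
pose a i j := (t`_i)^`(j).
have tl i : (i < k)%N -> t`_i = s`_i.
  by move=> ik; rewrite !nth_rcons size_rcons ltnS ltnW // ik.
have tg : t`_k = g by rewrite !nth_rcons size_rcons ltnSn ltnn eqxx.
have th : t`_k.+1 = h by rewrite nth_rcons size_rcons ltnn eqxx.
have E0 : wronskian s = natdet k a.
  by apply: eq_natdet => i j ik _; rewrite /a tl.
have E2 : wronskian t = natdet k.+2 a by rewrite /wronskian !size_rcons.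
have nthE u i : (i < k.+1)%N -> (rcons s u)`_i = if (i < k)%N then s`_i else u.
  move=> ik; rewrite nth_rcons -/k; case: ltnP => // ki.
  by rewrite -[i == k]/(i == k) eqn_leq ki -ltnS ik.
have E1 (u : {poly R}) r : t`_r = u -> wronskian (rcons s u) = natdet k.+1 (border k r k a).
  move=> tr; rewrite /wronskian size_rcons; apply: eq_natdet => i j ik jk.
  rewrite nthE // /border /a; congr (_^`(_)).
    by case: ltnP => // kj; apply/eqP; rewrite eqn_leq kj -ltnS jk.
  by case: ifP => // ik'; rewrite tl.
have E1' (u : {poly R}) r : t`_r = u ->
    (wronskian (rcons s u))^`() = natdet k.+1 (border k r k.+1 a).
  move=> tr; rewrite /wronskian size_rcons deriv_wronskian.
  apply: eq_natdet => i j ik jk; rewrite nthE // /border /a; congr (_^`(_)).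
  by case: ifP => // ik'; rewrite tl.
rewrite E0 -/t E2 (E1' _ _ tg) (E1' _ _ th) (E1 _ _ tg) (E1 _ _ th).
exact: natdet_desnanot.
Qed.

(** * The bilinear identity for Wronskians of Hermite functions *)

Section HermiteWronskian.
Variable (R : numFieldType) (h : nat -> {poly R}).
Hypothesis (h0 : forall n, h n != 0).
Hypothesis h_ode : forall n, (h n)^`()^`() = 2%:R * 'X * (h n)^`() - 2%:R * n%:R * h n.

Local Notation W s := (wronskian [seq h n | n <- s]).

Lemma wronskian_nil : wronskian [::] = 1 :> {poly R}.
Proof. exact: natdet0. Qed.

Lemma wronskian1 (p : {poly R}) : wronskian [:: p] = p.
Proof. by rewrite /wronskian /natdet det_mx11 mxE. Qed.

(** The left side is the derivative of [exp(-x^2) W(s,n,m) / W(s)], multiplied by [exp(x^2) W(s)^2]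
    to become polynomial. *)
Let hirota (s : seq nat) n m :=
  W s * (W (rcons (rcons s n) m))^`() - (W s)^`() * W (rcons (rcons s n) m)
    - 2%:R * 'X * W s * W (rcons (rcons s n) m) =
  2%:R * (n%:R - m%:R) * W (rcons s n) * W (rcons s m).

Let jacobi (s : seq nat) n m : W s != 0 ->
  W s * W (rcons (rcons s n) m) =
  W (rcons s n) * (W (rcons s m))^`() - (W (rcons s n))^`() * W (rcons s m).
Proof. by move=> W0; rewrite !map_rcons wronskian_jacobi. Qed.

(** If [W(s,n,m)] were zero, the left side of the identity would vanish, while the right side is a
    product of nonzero factors. *)
Lemma hirota_neq0 (s : seq nat) n m : n != m ->
  W (rcons s n) != 0 -> W (rcons s m) != 0 -> hirota s n m ->
  W (rcons (rcons s n) m) != 0.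
Proof.
move=> nm Wn Wm; rewrite /hirota; case: eqP => // ->.
rewrite derivC !mulr0 !subr0 => /esym/eqP.
rewrite !mulf_eq0 (negPf Wn) (negPf Wm) !orbF => /orP[].
  by rewrite -polyC_natr polyC_eq0 pnatr_eq0.
by rewrite subr_eq0 -!polyC_natr (inj_eq (@polyC_inj R)) eqr_nat (negPf nm).
Qed.

(* Jacobi's identity and the two hypotheses give the closed form [EU] of
   [W s * W (s, f, n, m)]; the claim follows by differentiating it. *)
Lemma hirota_rcons (s : seq nat) (f n m : nat) :
  W s != 0 -> W (rcons s f) != 0 ->
  hirota s f n -> hirota s f m -> hirota (rcons s f) n m.
Proof.
move=> t0 t10; have := @jacobi s f n t0; have := @jacobi s f m t0.
have := @jacobi (rcons s f) n m t10.
rewrite /hirota; set t := W s in t0 *; set t1 := W (rcons s f) in t10 *.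
set sn := W (rcons s n); set sm := W (rcons s m).
set s1n := W (rcons (rcons s f) n); set s1m := W (rcons (rcons s f) m).
set r := W _.
move=> Jr Jm Jn Hn Hm.
have {}Hn : t * s1n^`() = (t^`() + 2%:R * 'X * t) * s1n +
    2%:R * (f%:R - n%:R) * t1 * sn by rewrite -Hn; ring.
have {}Hm : t * s1m^`() = (t^`() + 2%:R * 'X * t) * s1m +
    2%:R * (f%:R - m%:R) * t1 * sm by rewrite -Hm; ring.
pose U := 2%:R * ((f%:R - m%:R) * sm * s1n - (f%:R - n%:R) * sn * s1m).
have EU : t * r = U.
  apply: (mulfI t10); rewrite mulrCA Jr mulrBr mulrCA [t * (_ * _)]mulrA Hm Hn /U.
  ring.
have EU' := congr1 (@deriv R) EU; rewrite derivM in EU'.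
(* The factor [t^2] makes [t r], [t s1n'] and [t s1m'] appear, whose values are known. *)
apply: (mulfI t0); apply: (mulfI t0).
have -> : t * (t * (t1 * r^`() - t1^`() * r - 2%:R * 'X * t1 * r)) =
   t1 * t * (t^`() * r + t * r^`()) - (t^`() * t1 + t1^`() * t
     + 2%:R * 'X * t1 * t) * (t * r) by ring.
rewrite EU' EU.
have -> : t1 * t * U^`() =
   2%:R * ((f%:R - m%:R) * (t * (t1 * sm^`()) * s1n + t1 * sm * (t * s1n^`()))
    - (f%:R - n%:R) * (t * (t1 * sn^`()) * s1m + t1 * sn * (t * s1m^`()))).
  rewrite /U -!polyC_natr -!polyCB !derivE. ring.
have -> : t1 * sm^`() = t * s1m + t1^`() * sm by rewrite Jm; ring.
have -> : t1 * sn^`() = t * s1n + t1^`() * sn by rewrite Jn; ring.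
rewrite Hn Hm /U; ring.
Qed.

Lemma hirota_nil n m : hirota [::] n m.
Proof.
have := @jacobi [::] n m; rewrite /hirota /= wronskian_nil !wronskian1 oner_eq0.
rewrite !mul1r derivC mulr1 mul0r => -> //; rewrite derivB !derivM !h_ode; ring.
Qed.

(** Simultaneous induction: the identity at length [k] gives nonvanishing at length [k + 2], and
    nonvanishing at lengths [k] and [k + 1] carries the identity to length [k + 1]. *)
Lemma wronskian_hirota_aux k :
  [/\ forall s, uniq s -> size s = k -> W s != 0,
      forall s, uniq s -> size s = k.+1 -> W s != 0 &
      forall s n m, uniq (rcons (rcons s n) m) -> size s = k -> hirota s n m].
Proof.
elim: k => [|k [IH1 IH2 IH3]]; split.
- by case=> //= _ _; rewrite wronskian_nil oner_eq0.
- by case=> [|n []] //= _ _; rewrite wronskian1.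
- by case=> // n m _ _; apply: hirota_nil.
- exact: IH2.
- move=> s; case/lastP: s => // s m; case/lastP: s => // s n us.
  rewrite !size_rcons => -[sk].
  move: (us); rewrite !rcons_uniq mem_rcons inE negb_or -andbA.
  move=> /and4P[mn ms ns us'].
  apply: hirota_neq0; last exact: IH3.
  - by rewrite eq_sym.
  - by apply: IH2; rewrite ?size_rcons ?sk // rcons_uniq ns.
  - by apply: IH2; rewrite ?size_rcons ?sk // rcons_uniq ms.
- move=> s n m; case/lastP: s => // s f us; rewrite size_rcons => -[sk].
  move: us; rewrite !rcons_uniq !(mem_rcons, inE, negb_or) -!andbA.
  case/andP=> mn /andP[mf] /andP[ms] /andP[nf] /andP[ns] /andP[fs us].
  apply: hirota_rcons.
  - exact: IH1.
  - by apply: IH2; rewrite ?size_rcons ?sk // rcons_uniq fs.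
  - by apply: IH3; rewrite // !rcons_uniq mem_rcons inE negb_or nf ns fs us.
  - by apply: IH3; rewrite // !rcons_uniq mem_rcons inE negb_or mf ms fs us.
Qed.

Lemma wronskian_neq0 s : uniq s -> W s != 0.
Proof. by have [+ _ _] := wronskian_hirota_aux (size s) => /(_ s) + us; apply. Qed.

Lemma wronskian_hirota s n m : uniq (rcons (rcons s n) m) ->
  W s * (W (rcons (rcons s n) m))^`() - (W s)^`() * W (rcons (rcons s n) m)
    - 2%:R * 'X * W s * W (rcons (rcons s n) m) =
  2%:R * (n%:R - m%:R) * W (rcons s n) * W (rcons s m).
Proof. by move=> us; have [_ _] := wronskian_hirota_aux (size s); apply. Qed.

End HermiteWronskian.

(** * Necessity: the norm formula *)

Section Quotient.
Variable R : rcfType.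
Implicit Types (A B p q : {poly R}).

(* The numerator of [exp (x ^ 2) * (exp (- x ^ 2) * A / B)^`()], over [B ^ 2]. *)
Definition gderiv A B := A^`() * B - A * B^`() - 2%:R * 'X * A * B.

Lemma poly_gt0_near p y : 0 < p.[y] ->
  exists2 d, 0 < d & 0 < p.[y + d] /\ 0 < p.[y - d].
Proof.
move=> py; have [d d0 dP] := poly_cont y p py.
exists (d / 2%:R); first by lra.
have /dP : `|y + d / 2%:R - y| < d.
  by rewrite [_ + _ - y]addrC addKr ger0_norm; lra.
have /dP : `|y - d / 2%:R - y| < d.
  by rewrite [_ - _ - y]addrC addKr normrN ger0_norm; lra.
by rewrite !ltr_distl; split; lra.
Qed.

Lemma exists_last_root p x : p != 0 -> root p x ->
  exists2 y, root p y & forall z, y < z -> ~~ root p z.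
Proof.
move=> p0 px; have xin := root_in_cauchy_bound p0 px.
have cb := @ge_cauchy_bound R p p0.
have [E|y _ /rootP py _ ny|c _ _ nc] := @prev_rootP R p (- cauchy_bound p) (cauchy_bound p).
- by rewrite E eqxx in p0.
- exists y => // z yz; case: (ltP z (cauchy_bound p)) => zb.
    by apply: ny; rewrite in_itv /= yz zb.
  by apply: cb; rewrite in_itv /= zb.
- by have := nc x xin; rewrite px.
Qed.

Lemma lead_coef_ge0_pinfty p : (forall x, 0 <= p.[x]) -> 0 <= lead_coef p.
Proof.
move=> p_ge0; have [->|p0] := eqVneq p 0; first by rewrite lead_coef0.
have := @sgp_pinftyP R _ p (@ge_cauchy_bound R p p0) (cauchy_bound p).
rewrite in_itv /= lexx => /(_ isT); rewrite /sgp_pinfty => E.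
by rewrite -sgr_ge0 -E sgr_ge0.
Qed.

(** [size] is the degree plus one; comparing the signs at both infinities makes the degree even. *)
Lemma odd_size_ge0 p : p != 0 -> (forall x, 0 <= p.[x]) -> odd (size p).
Proof.
move=> p0 p_ge0.
have := @sgp_minftyP R _ p (@le_cauchy_bound R p p0) (- cauchy_bound p).
rewrite in_itv /= lexx => /(_ isT); rewrite /sgp_minfty => E.
have : 0 <= (-1) ^+ (size p).-1 * lead_coef p by rewrite -sgr_ge0 -E sgr_ge0.
have lp : 0 < lead_coef p.
  by rewrite lt_neqAle eq_sym lead_coef_eq0 p0 lead_coef_ge0_pinfty.
rewrite pmulr_lge0 // -signr_odd; case: (size p) (size_poly_eq0 p) p0 => [|n] /=.
  by rewrite eqxx => <-.
by case: odd => //; rewrite expr1 oppr_ge0 ler10.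
Qed.

(** The term [- 2 x A B] dominates the other two, which have smaller degree. *)
Lemma size_gderiv A B : A * B != 0 ->
  size (gderiv A B) = (size (A * B)).+1 /\
  lead_coef (gderiv A B) = - (2%:R * lead_coef (A * B)).
Proof.
move=> AB0; have := AB0; rewrite mulf_eq0 negb_or => /andP[A0 B0].
have two0 : 2%:R != 0 :> R by rewrite pnatr_eq0.
have E : - (2%:R * 'X * A * B) = (- 2%:R) *: (A * B * 'X).
  by rewrite -mul_polyC polyCN polyC_natr; ring.
have szE : size (- (2%:R * 'X * A * B)) = (size (A * B)).+1.
  by rewrite E size_scale ?oppr_eq0 // size_mulX.
have szl : (size (A^`() * B - A * B^`())%R < (size (A * B)%R).+1)%N.
  rewrite ltnS (leq_trans (size_polyD _ _)) // size_polyN geq_max.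
  rewrite !(leq_trans (size_polyMleq _ _)) // size_mul // -!subn1 leq_sub2r //.
    by rewrite leq_add2l ltnW // lt_size_deriv.
  by rewrite leq_add2r ltnW // lt_size_deriv.
rewrite /gderiv [_ - 2%:R * _ * _ * _]addrC size_polyDl ?szE // lead_coefDl ?szE //.
by rewrite E lead_coefZ lead_coefMX mulNr.
Qed.

(* [exp (- x ^ 2) * A / B] cannot be nondecreasing unless it is zero, since it
   tends to zero at both infinities; the proof avoids [exp] by looking at the sign
   of [A * B] to the right of its last root. *)
Lemma gderiv_not_ge0 A B : (forall x, ~~ root B x) ->
  (forall x, 0 <= (gderiv A B).[x]) -> gderiv A B = 0.
Proof.
move=> nB q_ge0; have B0 : B != 0.
  by apply: contra (nB 0) => /eqP ->; rewrite root0.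
have [->|A0] := eqVneq A 0; first by rewrite /gderiv derivC !mul0r !mulr0 subrr mul0r subr0.
have AB0 : A * B != 0 by rewrite mulf_neq0.
have [szq lq] := size_gderiv AB0.
have q0 : gderiv A B != 0 by rewrite -size_poly_eq0 szq.
(* [A B] has odd degree and negative leading coefficient: it has a real root, and is negative to the
   right of the last one. *)
have szAB : ~~ odd (size (A * B)) by have := odd_size_ge0 q0 q_ge0; rewrite szq.
have lAB : lead_coef (A * B) < 0.
  rewrite lt_neqAle lead_coef_eq0 AB0 /=.
  by have := lead_coef_ge0_pinfty q_ge0; rewrite lq; lra.
have [x0 rx0] := odd_poly_root szAB.
have [y ry ny] := exists_last_root AB0 rx0; exfalso.
have ABneg z : y < z -> (A * B).[z] < 0.
  move=> yz; rewrite -sgr_cp0 (@sgp_pinftyP _ z) ?in_itv /= ?lexx //.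
    by rewrite /sgp_pinfty ltr0_sg.
  by move=> u; rewrite in_itv /= andbT => zu; apply: ny; apply: lt_le_trans zu.
have rAy : root A y by move: ry; rewrite rootM (negPf (nB y)) orbF.
have [[|m] [A1]] := multiplicity_XsubC A y; rewrite A0 /= => nA1 AE.
  by move: rAy; rewrite AE expr0 mulr1 (negPf nA1).
pose Y := 'X - y%:P.
(* [C] is [gderiv A B] with the factor [(X - y)^m] removed, where [y] is a root of [A] of order
   [m + 1]. *)
pose C := A1^`() * Y * B + m.+1%:R * A1 * B - A1 * Y * B^`() - 2%:R * 'X * A1 * Y * B.
have EC : gderiv A B = C * Y ^+ m.
  rewrite /gderiv /C AE derivM deriv_exp derivXsubC -/Y /= exprS -mulr_natl.
  by ring.
have Cy : C.[y] = m.+1%:R * (A1.[y] * B.[y]).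
  rewrite /C /Y !hornerE /= subrr -polyC_natr hornerC; ring.
have ABE z : (A * B).[z] = A1.[z] * B.[z] * (z - y) ^+ m.+1.
  by rewrite hornerM AE hornerM horner_exp hornerXsubC; ring.
have AB1 : (A1 * B).[y] != 0 by rewrite -rootE rootM negb_or nA1 nB.
(* A negative value makes [gderiv A B] negative just to the right of [y]; a positive one makes [A B]
   positive there. *)
have [neg|pos|/eqP] := ltgtP (A1 * B).[y] 0; last by rewrite (negPf AB1).
  have [|d d0 [pd _]] := @poly_gt0_near (- C) y.
    by rewrite hornerN Cy oppr_gt0 pmulr_rlt0 ?ltr0n // -hornerM.
  move: pd; have := q_ge0 (y + d); rewrite EC hornerM horner_exp hornerXsubC hornerN.
  by rewrite [_ + _ - y]addrC addKr pmulr_lge0 ?exprn_gt0 //; lra.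
have [d d0 [pd _]] := poly_gt0_near pos.
have yd : y < y + d by lra.
move: pd; have := ABneg _ yd.
by rewrite ABE [_ + _ - y]addrC addKr pmulr_llt0 ?exprn_gt0 // hornerM; lra.
Qed.

Lemma gderivMM p A B : gderiv (p * A) (p * B) = p ^+ 2 * gderiv A B.
Proof. by rewrite /gderiv !derivM; ring. Qed.

(** At a root of [B] of order [m + 1] the left side has order exactly [m], because of the term
    [A B'], while the right side has order at least [2 m + 2]. *)
Lemma gderiv_coprime_noroot (T A B D : {poly R}) : coprimep A B -> B != 0 ->
  (forall x, ~~ root T x) -> T ^+ 2 * gderiv A B = B ^+ 2 * D ->
  forall x, ~~ root B x.
Proof.
move=> cAB B0 nT E x; apply/negP => rBx.
have nA : ~~ root A x by apply: (coprimep_root (p := B)); rewrite 1?coprimep_sym.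
have [[|m] [B1]] := multiplicity_XsubC B x; rewrite B0 /= => nB1 BE.
  by move: rBx; rewrite BE expr0 mulr1 (negPf nB1).
pose Y := 'X - x%:P.
have Y0 : Y ^+ m != 0 by rewrite expf_neq0 // polyXsubC_eq0.
have : T ^+ 2 * (A^`() * B1 * Y - A * (B1^`() * Y + m.+1%:R * B1) - 2%:R * 'X * A * B1 * Y)
  = B1 ^+ 2 * Y ^+ m.+2 * D.
  apply: (mulIf Y0); transitivity (T ^+ 2 * gderiv A B).
    rewrite /gderiv BE derivM deriv_exp derivXsubC -/Y /= [Y ^+ m.+1]exprS -mulr_natl.
    by ring.
  by rewrite E BE -/Y !exprS; ring.
move/(congr1 (horner^~ x)); rewrite !exprS !hornerE /= subrr -polyC_natr hornerC.
rewrite !(mulr0, mul0r, subr0, add0r, sub0r) => /eqP.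
by rewrite mulr1 mulrN oppr_eq0 !mulf_eq0 -!rootE (negPf (nT x)) (negPf nA) (negPf nB1)
           pnatr_eq0.
Qed.
End Quotient.

(** * Norm formula for Wronskians and the sign of the node products *)

Section Necessity.
Variable (R : rcfType) (h : nat -> {poly R}).
Hypothesis (h0 : forall n, h n != 0).
Hypothesis h_ode : forall n, (h n)^`()^`() = 2%:R * 'X * (h n)^`() - 2%:R * n%:R * h n.

Local Notation W s := (wronskian [seq h n | n <- s]).

Definition nodes (s : seq nat) (n : nat) : R := \prod_(f <- s) (n%:R - f%:R).

(* [A / B] telescopes: appending [f] to [s] adds to it a multiple of
   [W (s, n) * W (s, f, n) / (W s * W (s, f))], see [gPQ]. *)
Lemma wronskian_norm (s : seq nat) n : uniq (rcons s n) ->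
  exists A B : {poly R}, B != 0 /\
    W (rcons s n) ^+ 2 * B ^+ 2 = W s ^+ 2 *
      (gderiv A B + (2%:R ^+ size s * nodes s n) *: (h n ^+ 2 * B ^+ 2)).
Proof.
elim/last_ind: s => [|s f IH] us.
  exists 0, 1; split; first exact: oner_neq0.
  rewrite /= wronskian_nil wronskian1 /nodes big_nil mulr1 expr0 scale1r.
  by rewrite /gderiv !derivC; ring.
have [usn usf] : uniq (rcons s n) /\ uniq (rcons s f).
  move: us; rewrite !rcons_uniq mem_rcons inE negb_or -!andbA.
  by move=> /and4P[_ -> -> ->].
have us0 : uniq s by move: usf; rewrite rcons_uniq => /andP[].
have [A [B [B0 IHE]]] := IH usn.
have H := wronskian_hirota h0 h_ode us.
have t0 := wronskian_neq0 h0 h_ode us0; have t10 := wronskian_neq0 h0 h_ode usf.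
have J : W s * W (rcons (rcons s f) n) =
    W (rcons s f) * (W (rcons s n))^`() - (W (rcons s f))^`() * W (rcons s n).
  by rewrite !map_rcons wronskian_jacobi.
have -> : 2%:R ^+ size (rcons s f) * nodes (rcons s f) n =
    2%:R * (n%:R - f%:R) * (2%:R ^+ size s * nodes s n).
  by rewrite /nodes -cats1 big_cat big_seq1 /= cats1 size_rcons exprS; ring.
move: H J IHE; set c := _ * nodes s n.
set t := W s in t0 *; set t1 := W (rcons s f) in t10 *.
set sn := W (rcons s n); set s1 := W (rcons (rcons s f) n).
move=> H J IHE.
pose d : {poly R} := 2%:R * (n%:R - f%:R).
have dE : (2%:R * (n%:R - f%:R))%:P = d :> {poly R}.
  by rewrite polyCM polyCB !polyC_natr.
have d' : d^`() = 0 by rewrite -dE derivC.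
(* The new fraction is [sn s1 / (t t1) + d A / B]. *)
exists (sn * s1 * B + d * A * (t * t1)), (t * t1 * B); split.
  by rewrite !mulf_neq0.
(* The product rule is grouped so that Jacobi's identity [J] and the bilinear identity [H] each
   evaluate one bracket. *)
have gPQ : gderiv (sn * s1) (t * t1) = t ^+ 2 * s1 ^+ 2 - d * (t1 ^+ 2 * sn ^+ 2).
  transitivity (s1 * t * (t1 * sn^`() - t1^`() * sn) + sn * t1 *
    (t * s1^`() - t^`() * s1 - 2%:R * 'X * t * s1)).
    by rewrite /gderiv !derivM; ring.
  by rewrite H -J /d; ring.
have -> : gderiv (sn * s1 * B + d * A * (t * t1)) (t * t1 * B) =
    B ^+ 2 * gderiv (sn * s1) (t * t1) + d * (t * t1) ^+ 2 * gderiv A B.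
  by rewrite /gderiv !(d', derivD, derivM); ring.
rewrite gPQ -mul_polyC polyCM dE.
move: IHE; rewrite -!mul_polyC => IHE.
transitivity (t1 ^+ 2 * (B ^+ 2 * (t ^+ 2 * s1 ^+ 2) + d * t1 ^+ 2 *
   (t ^+ 2 * (gderiv A B + c%:P * (h n ^+ 2 * B ^+ 2)) - sn ^+ 2 * B ^+ 2))).
  by rewrite -IHE; ring.
ring.
Qed.

(** Were the product negative, the norm formula would make the derivative of [exp(-x^2) A / B] a
    positive factor times a sum of two squares. Such a derivative is zero, so [h n] would vanish
    everywhere. *)
Lemma nodes_ge0 (s : seq nat) n : uniq s -> (forall x, ~~ root (W s) x) ->
  0 <= nodes s n.
Proof.
move=> us nW; have [ns|ns] := boolP (n \in s).
  by rewrite /nodes (big_rem _ ns) /= subrr mul0r.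
rewrite leNgt; apply/negP => c_lt0.
have [|A [B [B0 E]]] := @wronskian_norm s n; first by rewrite rcons_uniq ns.
move: E; set c := _ * nodes s n; set T := W s in nW *; set S := W (rcons s n).
have {}c_lt0 : c < 0 by rewrite pmulr_rlt0 // exprn_gt0 ?ltr0n.
(* In lowest terms the fraction has no real pole, by [gderiv_coprime_noroot]. *)
move=> E; pose g := gcdp A B; pose A0 := A %/ g; pose B0' := B %/ g.
have AE : A = g * A0 by rewrite mulrC divpK ?dvdp_gcdl.
have BE : B = g * B0' by rewrite mulrC divpK ?dvdp_gcdr.
have [g0 b0] : g != 0 /\ B0' != 0.
  by apply/andP; move: B0; rewrite BE mulf_eq0 negb_or.
have cop : coprimep A0 B0' by apply: coprimep_div_gcd; rewrite B0 orbT.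
have {}E : T ^+ 2 * gderiv A0 B0' = B0' ^+ 2 * (S ^+ 2 - c *: (T ^+ 2 * h n ^+ 2)).
  have g20 : g ^+ 2 != 0 by rewrite expf_neq0.
  apply: (mulfI g20); move: E; rewrite AE BE gderivMM -!mul_polyC => E.
  transitivity (T ^+ 2 * (g ^+ 2 * gderiv A0 B0' + c%:P * (h n ^+ 2 * (g * B0') ^+ 2))
    - T ^+ 2 * (c%:P * (h n ^+ 2 * (g * B0') ^+ 2))); first by ring.
  by rewrite -E; ring.
have nB := gderiv_coprime_noroot cop b0 nW E.
have T2 x : 0 < T.[x] ^+ 2 by rewrite exprn_even_gt0 //= -rootE nW.
have Ex x := congr1 (horner^~ x) E.
have q0 : gderiv A0 B0' = 0.
  apply: gderiv_not_ge0 => // x.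
  have c_le : c * (T.[x] ^+ 2 * (h n).[x] ^+ 2) <= 0.
    by rewrite nmulr_rle0 // mulr_ge0 ?sqr_ge0.
  have := Ex x; rewrite !(hornerM, hornerD, hornerN, hornerZ, horner_exp) => {}Ex.
  rewrite -(pmulr_rge0 _ (T2 x)) Ex mulr_ge0 ?sqr_ge0 //.
  by rewrite subr_ge0; apply: le_trans c_le (sqr_ge0 _).
(* The Cauchy bound serves as a point at which [h n] does not vanish. *)
have := @ge_cauchy_bound R (h n) (h0 n) (cauchy_bound (h n)).
rewrite in_itv /= lexx => /(_ isT) /negP[]; set x := cauchy_bound _.
have := Ex x; rewrite q0 mulr0.
rewrite !(horner0, hornerM, hornerD, hornerN, hornerZ, horner_exp) => /esym/eqP.
rewrite mulf_eq0 sqrf_eq0 -rootE (negPf (nB x)) /= => /eqP E0.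
have : 0 <= - c * (T.[x] ^+ 2 * (h n).[x] ^+ 2).
  by apply: mulr_ge0; [rewrite oppr_ge0 ltW | rewrite mulr_ge0 ?sqr_ge0].
have := sqr_ge0 S.[x]; move=> s1 s2.
have /eqP : - c * (T.[x] ^+ 2 * (h n).[x] ^+ 2) = 0 by lra.
by rewrite !mulf_eq0 oppr_eq0 (lt_eqF c_lt0) -!rootE (negPf (nW x)) /= orbb.
Qed.
End Necessity.

(** * Strict positivity *)

Lemma mulXsubCX_inj (R : idomainType) (x : R) (m l : nat) (C D : {poly R}) :
  C * ('X - x%:P) ^+ m = D * ('X - x%:P) ^+ l -> C.[x] != 0 -> D.[x] != 0 ->
  m = l.
Proof.
wlog lt_ml : m l C D / (m < l)%N => [hw E C0 D0|].
  by have [ml|lm|//] := ltngtP m l; [apply: hw E _ _ | apply/esym; apply: hw (esym E) _ _].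
rewrite -(subnK lt_ml) addnS exprS exprD -addnS => E C0 D0.
have Y0 : ('X - x%:P) ^+ m != 0 by rewrite expf_neq0 // polyXsubC_eq0.
have : C = D * ('X - x%:P) * ('X - x%:P) ^+ (l - m.+1).
  by apply: (mulIf Y0); rewrite E; ring.
by move/(congr1 (horner^~ x)); rewrite !hornerM hornerXsubC subrr mulr0 mul0r
  => /eqP; rewrite (negPf C0).
Qed.

Lemma polyXsubC_factor (R : idomainType) (p : {poly R}) x : p != 0 ->
  exists m q, p = q * ('X - x%:P) ^+ m /\ q.[x] != 0.
Proof.
move=> p0; have [m [q]] := multiplicity_XsubC p x; rewrite p0 => /= nq ->.
by exists m, q.
Qed.

(** The extra factor [X - x] avoids the exponent [m - 1], so that [m = 0] needs no separate
    treatment in order counts. *)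
Lemma XsubC_deriv_factor (R : comNzRingType) (q : {poly R}) x m :
  ('X - x%:P) * (q * ('X - x%:P) ^+ m)^`() =
  (m%:R * q + ('X - x%:P) * q^`()) * ('X - x%:P) ^+ m.
Proof.
rewrite derivM deriv_exp derivXsubC; case: m => [|m].
  by rewrite mulr0n expr0 /=; ring.
by rewrite /= -mulr_natl exprS; ring.
Qed.

Section Strictness.
Variable (R : rcfType) (h : nat -> {poly R}).
Hypothesis (h0 : forall n, h n != 0).
Hypothesis h_ode : forall n, (h n)^`()^`() = 2%:R * 'X * (h n)^`() - 2%:R * n%:R * h n.

Local Notation W s := (wronskian [seq h n | n <- s]).

Lemma wronskian_ge0_noroot (s : seq nat) n m x :
  uniq (rcons (rcons s n) m) -> ~~ root (W s) x ->
  (forall y, 0 <= (W (rcons (rcons s n) m)).[y]) ->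
  ~~ root (W (rcons (rcons s n) m)) x.
Proof.
move=> us nW V_ge0; apply/negP => rV.
have H := wronskian_hirota h0 h_ode us; have V0 := wronskian_neq0 h0 h_ode us.
have := us; rewrite rcons_uniq mem_rcons inE negb_or => /andP[/andP[mn ms] usn].
have usm : uniq (rcons s m).
  by rewrite rcons_uniq ms; move: usn; rewrite rcons_uniq => /andP[].
have us0 : uniq s by move: usm; rewrite rcons_uniq => /andP[].
have sn0 := wronskian_neq0 h0 h_ode usn; have sm0 := wronskian_neq0 h0 h_ode usm.
have t0 := wronskian_neq0 h0 h_ode us0.
have J : W s * W (rcons (rcons s n) m) =
    W (rcons s n) * (W (rcons s m))^`() - (W (rcons s n))^`() * W (rcons s m).
  by rewrite !map_rcons wronskian_jacobi.
move: H J V_ge0 rV V0 nW sn0 sm0 t0.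
set t := W s; set sn := W (rcons s n); set sm := W (rcons s m); set V := W _.
move=> H J V_ge0 rV V0 nW sn0 sm0 t0.
have [e [V1 [VE V1x]]] := polyXsubC_factor x V0.
have [a [A [AE Ax]]] := polyXsubC_factor x sn0.
have [b [B [BE Bx]]] := polyXsubC_factor x sm0.
pose Y := 'X - x%:P; have Yx : Y.[x] = 0 by rewrite hornerXsubC subrr.
have tx : t.[x] != 0 by [].
have e0 : e != 0%N.
  by apply: contraL rV => /eqP e0; rewrite VE e0 expr0 mulr1.
(* Orders at [x] in [H], multiplied by [X - x]: [e] on the left, with leading value [e t(x) V1(x)],
   and [a + b + 1] on the right. *)
have eE : e = (a + b).+1.
  pose C := t * (e%:R * V1 + Y * V1^`()) - t^`() * Y * V1 - 2%:R * 'X * t * Y * V1.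
  pose D := (2%:R * (n%:R - m%:R)) * A * B.
  apply: (@mulXsubCX_inj _ x e (a + b).+1 C D).
  - transitivity (Y * (t * V^`() - t^`() * V - 2%:R * 'X * t * V)).
      rewrite /C -/Y; have := XsubC_deriv_factor V1 x e; rewrite -VE -/Y => VE'.
      transitivity (t * (Y * V^`()) - t^`() * Y * V - 2%:R * 'X * t * Y * V); last by ring.
      by rewrite VE' VE -/Y; ring.
    by rewrite H /D AE BE exprS exprD -/Y; ring.
  - rewrite /C !(Yx, hornerD, hornerN, hornerM) !(mulr0, mul0r, addr0, subr0) -polyC_natr hornerC.
    by rewrite !mulf_neq0 // pnatr_eq0.
  - rewrite /D !hornerM -!polyC_natr -polyCB !hornerC !mulf_neq0 //.
      by rewrite pnatr_eq0.
    by rewrite subr_eq0 eqr_nat eq_sym.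
(* Orders in [J], again multiplied by [X - x]: if [a] and [b] differ, the leading value
   [(b - a) A(x) B(x)] is nonzero and [e + 1 = a + b], against [eE]. *)
have ab : a = b.
  apply/eqP; apply: contraT => nab.
  pose C := t * V1; pose D := A * (b%:R * B + Y * B^`()) - (a%:R * A + Y * A^`()) * B.
  suff /eqP : e.+1 = (a + b)%N by rewrite eE -addn2 -[X in _ == X]addn0 eqn_add2l.
  apply: (@mulXsubCX_inj _ x _ _ C D).
  - transitivity (Y * (t * V)); first by rewrite /C VE exprS -/Y; ring.
    have := XsubC_deriv_factor A x a; have := XsubC_deriv_factor B x b.
    rewrite -AE -BE -/Y => BE' AE'.
    rewrite J; transitivity (sn * (Y * sm^`()) - (Y * sn^`()) * sm); first by ring.
    by rewrite AE' BE' AE BE -/Y /D exprD; ring.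
  - by rewrite /C hornerM mulf_neq0.
  - rewrite /D !(Yx, hornerD, hornerN, hornerM) !(mul0r, addr0) -!polyC_natr !hornerC.
    have -> : A.[x] * (b%:R * B.[x]) - a%:R * A.[x] * B.[x] =
      (b%:R - a%:R) * (A.[x] * B.[x]) by ring.
    by rewrite !mulf_neq0 // subr_eq0 eqr_nat eq_sym.
(* The order [2 a + 1] is odd, so [V] changes sign at [x]. *)
have Vy y : V.[y] = V1.[y] * (y - x) ^+ (a + a).+1.
  by rewrite VE hornerM horner_exp hornerXsubC eE ab.
have [neg|pos|/eqP] := ltgtP V1.[x] 0; last by rewrite (negPf V1x).
  have [|d d0 [pd _]] := @poly_gt0_near _ (- V1) x; first by rewrite hornerN oppr_gt0.
  have := V_ge0 (x + d); rewrite Vy [_ + _ - x]addrC addKr pmulr_lge0 ?exprn_gt0 //.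
  by move: pd; rewrite hornerN; lra.
have [d d0 [_ pd]] := poly_gt0_near pos.
have := V_ge0 (x - d); rewrite Vy [_ - _ - x]addrC addKr pmulr_rge0 //.
by rewrite exprNn -signr_odd /= oddD addbb expr1 mulN1r oppr_ge0 leNgt exprn_gt0.
Qed.
End Strictness.

(** * Krawtchouk polynomials *)

Section Krawtchouk.
Variable R : realFieldType.
Variable N : nat.

(* With p = 1/2 and the normalization that makes the degree [n] and the variable
   [x] play symmetric roles. *)
Definition kraw_coef (n j : nat) : R := (- 2%:R) ^+ j * 'C(n, j)%:R / 'C(N, j)%:R.

Definition kraw (n x : nat) : R := \sum_(j < N.+1) kraw_coef n j * 'C(x, j)%:R.

(** Self-duality: each term depends on [n] and [x] through ['C(n, j) 'C(x, j)] only. *)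
Lemma kraw_sym n x : kraw n x = kraw x n.
Proof. by apply: eq_bigr => j _; rewrite /kraw_coef; ring. Qed.

Lemma natrB_bin (n m : nat) : (n - m)%:R * 'C(n, m)%:R = (n%:R - m%:R) * 'C(n, m)%:R :> R.
Proof.
have [nm|mn] := ltnP n m; first by rewrite bin_small // !mulr0.
by rewrite natrB.
Qed.

Lemma binr_left (n m : nat) :
  m.+1%:R * 'C(n, m.+1)%:R = (n%:R - m%:R) * 'C(n, m)%:R :> R.
Proof. by rewrite -natrM mul_bin_left natrM natrB_bin. Qed.

Lemma binr_down (n m : nat) :
  n%:R * 'C(n.-1, m)%:R = (n%:R - m%:R) * 'C(n, m)%:R :> R.
Proof. by rewrite -natrM mul_bin_down natrM natrB_bin. Qed.

(** The difference of the two sides telescopes along [U], whose last value contains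
    ['C(x, N + 1) = 0]. For [n = 0] the value at [n.-1] is multiplied by zero. *)
Lemma kraw_rec n x : (x <= N)%N ->
  (N%:R - n%:R) * kraw n.+1 x =
  (N%:R - 2%:R * x%:R) * kraw n x - n%:R * kraw n.-1 x.
Proof.
move=> xN; apply/eqP; rewrite -subr_eq0; apply/eqP.
pose U j : R := if j is l.+1 then
  2%:R * kraw_coef n l * (l.+1%:R * 'C(x, l.+1)%:R) else 0.
rewrite /kraw !mulr_sumr -sumrB -sumrB.
rewrite (eq_bigr (fun j : 'I_N.+1 => U j.+1 - U j)); last first.
  move=> j _; rewrite /U binr_left.
  have NC : ('C(N, j)%:R : R) != 0 by rewrite pnatr_eq0 -lt0n bin_gt0 -ltnS.
  have hd : n%:R * kraw_coef n.-1 j = (n%:R - j%:R) * kraw_coef n j.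
    transitivity ((- 2%:R) ^+ j * (n%:R * 'C(n.-1, j)%:R) / 'C(N, j)%:R : R).
      by rewrite /kraw_coef; ring.
    by rewrite binr_down /kraw_coef; ring.
  case: (nat_of_ord j) (ltn_ord j) NC hd => [_ _|l lN NC] hd.
    rewrite [n%:R * _]mulrA hd subr0 /kraw_coef !bin0 expr0 !mul1r invr1; ring.
  rewrite [n%:R * _]mulrA hd.
  have NC' : ('C(N, l)%:R : R) != 0 by rewrite pnatr_eq0 -lt0n bin_gt0; lia.
  have Nl : (N%:R - l%:R : R) != 0 by rewrite subr_eq0 eqr_nat; lia.
  have -> : kraw_coef n l = (- 2%:R)^+ l * 'C(n, l)%:R * (N%:R - l%:R) / (l.+1%:R * 'C(N, l.+1)%:R).
    by rewrite binr_left /kraw_coef; field; rewrite NC' Nl.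
  have l0 : (l.+1%:R : R) != 0 by rewrite pnatr_eq0.
  have nE : 'C(n, l.+1)%:R = (n%:R - l%:R) * 'C(n, l)%:R / l.+1%:R :> R.
    by rewrite -binr_left [l.+1%:R * _]mulrC mulfK.
  rewrite /kraw_coef binS natrD nE exprS -[l.+1%:R]natr1; field.
  by rewrite NC natr1 l0.
rewrite -(big_mkord xpredT (fun j => U j.+1 - U j)) telescope_sumr //.
by rewrite subr0 /U bin_small // !mulr0.
Qed.

Definition binp (j : nat) : {poly R} := (j`!%:R)^-1 *: \prod_(i < j) ('X - i%:R%:P).

Lemma binpE j x : (binp j).[x%:R] = 'C(x, j)%:R.
Proof.
have f0 : (j`!%:R : R) != 0 by rewrite pnatr_eq0 -lt0n fact_gt0.
rewrite hornerZ; apply: (mulfI f0); rewrite mulVKf // -natrM mulnC bin_ffact.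
rewrite horner_prod.
elim: j {f0} => [|j IH]; first by rewrite big_ord0.
rewrite big_ord_recr /= IH ffactnSr natrM hornerXsubC.
have [jx|xj] := leqP j x; first by rewrite natrB.
by rewrite ffact_small // !mul0r.
Qed.

Lemma size_prod_natX j : size (\prod_(i < j) ('X - i%:R%:P) : {poly R}) = j.+1.
Proof. by rewrite size_prod_XsubC /index_enum -enumT size_enum_ord. Qed.

Lemma size_binp j : (size (binp j) = j.+1)%N.
Proof.
by rewrite size_scale ?size_prod_natX // invr_eq0 pnatr_eq0 -lt0n fact_gt0.
Qed.

Lemma coef_binp j : (binp j)`_j = (j`!%:R)^-1.
Proof.
have := monic_prod_XsubC (index_enum 'I_j) xpredT (fun i => (i%:R : R)).
rewrite monicE lead_coefE size_prod_natX /= => /eqP E.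
by rewrite coefZ E mulr1.
Qed.

Definition krawp (n : nat) : {poly R} := \sum_(j < N.+1) kraw_coef n j *: binp j.

Lemma krawpE n x : (krawp n).[x%:R] = kraw n x.
Proof.
by rewrite horner_sum; apply: eq_bigr => j _; rewrite hornerZ binpE.
Qed.

Lemma size_krawp n : (size (krawp n) <= n.+1)%N.
Proof.
apply: (leq_trans (size_sum _ _ _)); apply/bigmax_leqP => j _.
have [jn|nj] := leqP j n.
  by rewrite (leq_trans (size_scale_leq _ _)) // size_binp.
by rewrite /kraw_coef bin_small // mulr0 mul0r scale0r size_poly0.
Qed.

Definition kraw_lead n : R := kraw_coef n n / n`!%:R.

Lemma coef_krawp n : (n <= N)%N -> (krawp n)`_n = kraw_lead n.
Proof.
move=> nN; rewrite coef_sum (bigD1 (inord n)) //= inordK // big1 => [|j].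
  by rewrite addr0 coefZ coef_binp.
rewrite -val_eqE /= inordK // => jn; rewrite coefZ.
have [lt|gt|E] := ltngtP j n; last by rewrite E eqxx in jn.
  by rewrite nth_default ?mulr0 // size_binp.
by rewrite /kraw_coef bin_small // mulr0 !mul0r.
Qed.

Lemma kraw_lead_sign n : (n <= N)%N -> 0 < (-1) ^+ n * kraw_lead n.
Proof.
move=> nN; rewrite /kraw_lead /kraw_coef binn !mulrA -exprMn mulrN mulN1r opprK.
by rewrite mulr1 !divr_gt0 ?exprn_gt0 ?ltr0n ?bin_gt0 ?fact_gt0.
Qed.

Lemma kraw_lead_neq0 n : (n <= N)%N -> kraw_lead n != 0.
Proof.
by move/kraw_lead_sign; rewrite lt0r mulf_eq0 negb_or => /andP[/andP[]].
Qed.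

(** Inner product for the unnormalized binomial weight on [{0, ..., N}]. *)
Definition kip (p q : {poly R}) : R :=
  \sum_(x < N.+1) 'C(N, x)%:R * (p.[x%:R] * q.[x%:R]).

Lemma kipC p q : kip p q = kip q p.
Proof. by apply: eq_bigr => x _; ring. Qed.

Lemma kipDr p q r : kip p (q + r) = kip p q + kip p r.
Proof. by rewrite -big_split; apply: eq_bigr => x _ /=; rewrite hornerD; ring. Qed.

Lemma kipZr p c q : kip p (c *: q) = c * kip p q.
Proof. by rewrite /kip mulr_sumr; apply: eq_bigr => x _; rewrite hornerZ; ring. Qed.

(** The recurrence read through self-duality: a difference operator in [x] with eigenvalue
    [N - 2 n]. *)
Lemma kraw_diff n x : (n <= N)%N ->
  (N%:R - 2%:R * n%:R) * kraw n x = (N%:R - x%:R) * kraw n x.+1 + x%:R * kraw n x.-1.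
Proof. by move=> nN; rewrite !(kraw_sym n) kraw_rec //; ring. Qed.

(* The right-hand side is symmetric in [n] and [m]. *)
Lemma kraw_selfadj n m : (n <= N)%N ->
  (N%:R - 2%:R * n%:R) * kip (krawp n) (krawp m) =
  \sum_(x < N) 'C(N, x)%:R * (N%:R - x%:R) * (kraw n x.+1 * kraw m x + kraw n x * kraw m x.+1).
Proof.
move=> nN; rewrite /kip mulr_sumr.
rewrite (eq_bigr (fun x : 'I_N.+1 => 'C(N, x)%:R * (N%:R - x%:R) * (kraw n x.+1 * kraw m x)
   + x%:R * 'C(N, x)%:R * (kraw n x.-1 * kraw m x))); last first.
  move=> x _; rewrite !krawpE.
  transitivity ('C(N, x)%:R * ((N%:R - 2%:R * n%:R) * kraw n x) * kraw m x); first by ring.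
  by rewrite kraw_diff //; ring.
(* The boundary terms at [x = N] and [x = 0] vanish; the shift of the second sum uses
   [(x + 1) 'C(N, x + 1) = (N - x) 'C(N, x)]. *)
rewrite big_split /= big_ord_recr /= subrr mulr0 mul0r addr0.
rewrite big_ord_recl /= !mul0r add0r -big_split /=; apply: eq_bigr => x _.
by rewrite /bump /= add1n binr_left; ring.
Qed.

(** Eigenvectors of a symmetric operator for the distinct eigenvalues [N - 2 n] and [N - 2 m]. *)
Lemma kraw_orth n m : (n <= N)%N -> (m <= N)%N -> n != m ->
  kip (krawp n) (krawp m) = 0.
Proof.
move=> nN mN nm; have E : (N%:R - 2%:R * n%:R) * kip (krawp n) (krawp m) =
    (N%:R - 2%:R * m%:R) * kip (krawp n) (krawp m).
  rewrite [in RHS]kipC !kraw_selfadj //; apply: eq_bigr => x _; ring.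
have /eqP : 2%:R * (m%:R - n%:R) * kip (krawp n) (krawp m) = 0.
  by apply/eqP; rewrite -subr_eq0 in E *; move/eqP: E => E; apply/eqP; lra.
by rewrite !mulf_eq0 pnatr_eq0 /= subr_eq0 eqr_nat eq_sym (negPf nm) => /eqP.
Qed.

Lemma size_sub_krawp (p : {poly R}) n : (n <= N)%N -> (size p <= n.+1)%N ->
  (size (p - (p`_n / kraw_lead n) *: krawp n)%R <= n)%N.
Proof.
move=> nN sp; apply/leq_sizeP => j; rewrite leq_eqVlt => /orP[/eqP <-|nj].
  rewrite coefB coefZ coef_krawp // divfK ?subrr ?kraw_lead_neq0 //.
rewrite coefB coefZ (nth_default _ (leq_trans sp nj)).
by rewrite (nth_default _ (leq_trans (size_krawp n) nj)) mulr0 subrr.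
Qed.

Lemma kraw_orth_low n (p : {poly R}) : (n <= N)%N -> (size p <= n)%N -> kip (krawp n) p = 0.
Proof.
move=> nN; move: {1 3}n (leqnn n) => m; elim: m p => [|m IH] p.
  move=> _; rewrite leqn0 size_poly_eq0 => /eqP ->; rewrite /kip big1 // => x _.
  by rewrite horner0 !mulr0.
move=> mn sp; have mN : (m <= N)%N by lia.
have := size_sub_krawp mN sp; set c := _ / _ => sq.
rewrite -[p](subrK (c *: krawp m)) kipDr kipZr IH ?(ltnW mn) //.
by rewrite kraw_orth ?mulr0 ?addr0 // gtn_eqF.
Qed.

Lemma kip_gt0 (p : {poly R}) (x : nat) (w : nat -> R) : (x <= N)%N -> p.[x%:R] != 0 ->
  (forall y, (y <= N)%N -> 0 <= w y) -> w x != 0 ->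
  0 < \sum_(y < N.+1) 'C(N, y)%:R * (w y * p.[y%:R] ^+ 2).
Proof.
move=> xN px w0 wx; rewrite (bigD1 (inord x)) //= inordK // ltr_pwDl //.
  by rewrite mulr_gt0 ?ltr0n ?bin_gt0 // mulr_gt0 ?lt0r ?wx ?w0 // ?expf_neq0 ?sqr_ge0.
apply: sumr_ge0 => y _; rewrite mulr_ge0 ?ler0n // mulr_ge0 ?sqr_ge0 //.
by rewrite w0 // -ltnS.
Qed.

(** The value at [0] is [1], so the sum of squares has a positive term. *)
Lemma kraw_norm_gt0 n : 0 < kip (krawp n) (krawp n).
Proof.
have -> : kip (krawp n) (krawp n) =
    \sum_(y < N.+1) 'C(N, y)%:R * (1 * (krawp n).[y%:R] ^+ 2).
  by apply: eq_bigr => y _; rewrite mul1r expr2.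
apply: (@kip_gt0 _ 0 (fun=> 1)); rewrite ?oner_eq0 //.
rewrite -[0]/(0%:R : R) krawpE /kraw big_ord_recl big1 => [|j _].
  by rewrite /kraw_coef !bin0 expr0 invr1 !mulr1 addr0 oner_eq0.
by rewrite bin0n mulr0.
Qed.

Lemma kip_top n (p : {poly R}) : (n <= N)%N -> (size p <= n.+1)%N ->
  kip (krawp n) p = p`_n / kraw_lead n * kip (krawp n) (krawp n).
Proof.
move=> nN sp; have := size_sub_krawp nN sp; set c := _ / _ => sq.
by rewrite -[p in LHS](subrK (c *: krawp n)) kipDr kipZr kraw_orth_low ?add0r.
Qed.

End Krawtchouk.

(** * Sign of the Krawtchouk Casoratians *)

Section Christoffel.
Variable R : realFieldType.
Variable N : nat.
Variable s : seq nat.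
Hypothesis s_sorted : sorted ltn s.

Let k := size s.
Let node (i : nat) : R := (nth 0%N s i)%:R.

(** Degrees [n + j] at the nodes [s], as Christoffel's formula requires; by [kraw_sym] it is also
    the Casoratian at [n] of the Krawtchouk polynomials indexed by [s]. *)
Definition casoratian (n : nat) : R :=
  natdet k (fun i j => kraw R N (n + j) (nth 0%N s i)).

Let weight (x : nat) : R := \prod_(f <- s) (x%:R - f%:R).

Let s_uniq : uniq s.
Proof. exact: (sorted_uniq ltn_trans ltnn s_sorted). Qed.

(** For [n = 0] the matrix is a Vandermonde matrix with increasing nodes times a triangular
    coefficient matrix whose diagonal entries have sign [(-1)^j]. *)
Lemma casoratian0_sign : (k <= N)%N -> 0 < (\prod_(j < k) (-1) ^+ j) * casoratian 0.
Proof.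
move=> kN.
pose V := Vandermonde k (\row_(i < k) node i).
pose U := \matrix_(i < k, j < k) (krawp R N j)`_i.
have -> : casoratian 0 = \det V * \det U.
  rewrite -(det_tr V) -det_mulmx; congr (\det _); apply/matrixP => i j.
  rewrite !mxE -krawpE (@horner_coef_wide _ k).
    by apply: eq_bigr => l _; rewrite !mxE mulrC.
  by rewrite (leq_trans (size_krawp _ _ _)) ?ltn_ord.
rewrite det_Vandermonde -det_tr det_trig; last first.
  apply/is_trig_mxP => i j ij; rewrite !mxE nth_default //.
  by rewrite (leq_trans (size_krawp _ _ _)).
rewrite mulrCA -big_split /=; apply: mulr_gt0.
  apply: prodr_gt0 => i _; apply: prodr_gt0 => j ij; rewrite !mxE subr_gt0 ltr_nat.
  by apply: (sorted_ltn_nth ltn_trans 0%N s_sorted); rewrite ?inE.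
apply: prodr_gt0 => i _; rewrite !mxE coef_krawp ?kraw_lead_sign //.
all: by have := ltn_ord i; lia.
Qed.

(** The [c j] are the cofactors of a last row formed by the polynomials of degrees [n + j]; at a
    node this row repeats an earlier one. *)
Lemma christoffel_poly n : exists c : nat -> R,
  [/\ c k = casoratian n, c 0%N = (-1) ^+ k * casoratian n.+1 &
    forall i, (i < k)%N -> root (\sum_(j < k.+1) c j *: krawp R N (n + j)) (node i)].
Proof.
pose a (r : nat -> R) i j := if (i < k)%N then (krawp R N (n + j)).[node i] else r j.
pose A r : 'M[R]_k.+1 := \matrix_(i, j) a r i j.
exists (fun j => cofactor (A (fun=> 0)) ord_max (inord j)); split.
- rewrite /cofactor inordK // addnn -signr_odd odd_double expr0 mul1r.
  congr (\det _); apply/matrixP => i j; rewrite !mxE /a !lift_max.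
  by have -> : inord k = ord_max :> 'I_k.+1; [apply/val_inj; rewrite /= inordK |
    rewrite lift_max ltn_ord krawpE].
- rewrite /cofactor inordK // addn0; congr (_ * \det _).
  apply/matrixP => i j; rewrite !mxE /a !lift_max ltn_ord krawpE.
  have -> : inord 0 = ord0 :> 'I_k.+1 by apply/val_inj; rewrite /= inordK.
  by rewrite lift0 addSnnS.
move=> i ik; pose r j := (krawp R N (n + j)).[node i].
have detA : \det (A r) = 0.
  have ik' : (i < k.+1)%N by exact: ltnW.
  apply: (@determinant_alternate _ _ _ (Ordinal ik') ord_max).
    by rewrite -val_eqE /= neq_ltn ik.
  by move=> j; rewrite !mxE /a /= ik ltnn.
apply/rootP; rewrite -[RHS]detA (expand_det_row _ ord_max) horner_sum.
apply: eq_bigr => j _; rewrite hornerZ mulrC !mxE /a /= ltnn; congr (_ * _).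
rewrite inord_val /cofactor; congr (_ * \det _).
by apply/matrixP => i' j'; rewrite !mxE /a !lift_max ltn_ord.
Qed.

(* [q] below is, up to a factor, the [n]th orthogonal polynomial for the weight
   multiplied by [weight], and [S1] computes its norm. *)
Lemma casoratian_step n : (n + k <= N)%N ->
  (forall x, (x <= N)%N -> 0 <= weight x) ->
  casoratian n != 0 -> 0 < casoratian n * casoratian n.+1.
Proof.
move=> nkN w0 On; have [c [ck c0 croot]] := christoffel_poly n.
set p := \sum_(j < k.+1) _ in croot.
have pcoef : p`_(n + k) = casoratian n * kraw_lead R N (n + k).
  rewrite /p big_ord_recr /= coefD coefZ coef_krawp // ck coef_sum big1 ?add0r // => j _.
  rewrite coefZ nth_default ?mulr0 // (leq_trans (size_krawp _ _ _)) //.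
  by rewrite ltn_add2l.
have pc0 : p`_(n + k) != 0 by rewrite pcoef mulf_neq0 // kraw_lead_neq0.
have szp : size p = (n + k).+1.
  apply/eqP; rewrite eqn_leq; apply/andP; split; last first.
    by rewrite ltnNge; apply: contra pc0 => sp; rewrite nth_default.
  apply: (leq_trans (size_sum _ _ _)); apply/bigmax_leqP => j _.
  apply: (leq_trans (size_scale_leq _ _)); apply: (leq_trans (size_krawp _ _ _)).
  by have := ltn_ord j; lia.
pose rs := [seq (f%:R : R) | f <- s].
have urs : uniq rs by rewrite map_inj_uniq // => x y /eqP; rewrite eqr_nat => /eqP.
have [||q pE] := @uniq_roots_prod_XsubC _ p rs.
- apply/(all_nthP 0) => i; rewrite size_map => ik.
  by rewrite (nth_map 0%N) // croot.
- by rewrite uniq_rootsE.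
pose w := \prod_(z <- rs) ('X - z%:P).
have wE x : w.[x%:R] = weight x.
  by rewrite horner_prod big_map; apply: eq_bigr => f _; rewrite hornerXsubC.
have wm : w \is monic by apply: monic_prod_XsubC.
have szw : size w = k.+1 by rewrite size_prod_XsubC size_map.
have szq : size q = n.+1.
  have := szp; rewrite pE size_Mmonic //; last first.
    by apply/eqP => q0; move: szp; rewrite pE q0 mul0r size_poly0.
  by rewrite -/w szw addnS /= -addSn => /addIn.
have qn : q`_n = casoratian n * kraw_lead R N (n + k).
  rewrite -pcoef; have := lead_coef_Mmonic q wm.
  by rewrite /w -pE !lead_coefE szp szq /= => ->.
(* [q] has degree [n], so in the expansion of [p] only the term of degree [n], with coefficient
   [c 0], is not orthogonal to [q]. *)
have S1 : \sum_(y < N.+1) 'C(N, y)%:R * (weight y * q.[y%:R] ^+ 2) =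
    c 0%N * (q`_n / kraw_lead R N n * kip N (krawp R N n) (krawp R N n)).
  transitivity (kip N q p).
    by apply: eq_bigr => y _; rewrite pE hornerM -/w wE; ring.
  rewrite /p (big_morph (kip N q) (id1 := 0) (op1 := +%R)); last 2 first.
  - by move=> ? ?; rewrite kipDr.
  - by rewrite /kip big1 // => x _; rewrite horner0 !mulr0.
  rewrite big_ord_recl /= addn0 kipZr kipC kip_top ?szq //; last by lia.
  rewrite big1 ?addr0 // => j _; rewrite kipZr kipC kraw_orth_low ?mulr0 //.
    by have := ltn_ord j; rewrite /bump /=; lia.
  by rewrite szq /bump /=; lia.
(* [p] has degree [n + k <= N] and cannot vanish at all [N + 1] lattice points. *)
have [x xN px] : exists2 x, (x <= N)%N & p.[x%:R] != 0.
  pose xs := [seq (x%:R : R) | x <- iota 0 N.+1].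
  have p0 : p != 0 by rewrite -size_poly_eq0 szp.
  have uxs : uniq xs by rewrite map_inj_uniq ?iota_uniq // => x y /eqP; rewrite eqr_nat => /eqP.
  have : ~~ all (root p) xs.
    apply: contraL nkN => rp; have := max_poly_roots p0 rp uxs.
    by rewrite size_map size_iota szp; lia.
  rewrite all_map -has_predC => /hasP[x]; rewrite mem_iota => /andP[_ xN] /= rx.
  by exists x; [lia | rewrite -rootE].
move: px; rewrite pE hornerM -/w wE mulf_eq0 negb_or => /andP[qx wx].
have := kip_gt0 xN qx w0 wx; rewrite S1 c0 qn.
have l1 := @kraw_lead_sign R N n; have l2 := @kraw_lead_sign R N (n + k).
have nN : (n <= N)%N by lia.
have K := kraw_norm_gt0 R N n.
(* The sign [(-1)^k] of [c 0] is absorbed by the signs of the two leading coefficients. *)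
have -> : (-1) ^+ k * casoratian n.+1 *
    (casoratian n * kraw_lead R N (n + k) / kraw_lead R N n * kip N (krawp R N n) (krawp R N n)) =
  casoratian n * casoratian n.+1 * (((-1) ^+ (n + k) * kraw_lead R N (n + k)) /
     ((-1) ^+ n * kraw_lead R N n) * kip N (krawp R N n) (krawp R N n)).
  have e : ((-1) ^+ n : R) != 0 by rewrite signr_eq0.
  have := kraw_lead_neq0 R nN => l0.
  by rewrite exprD; field; rewrite l0 e.
by rewrite pmulr_lgt0 // mulr_gt0 // divr_gt0 ?l1 ?l2.
Qed.

Lemma casoratian_sign n : (n + k <= N)%N ->
  (forall x, (x <= N)%N -> 0 <= weight x) ->
  0 < (\prod_(j < k) (-1) ^+ j) * casoratian n.
Proof.
move=> nkN w0; elim: n nkN => [|n IH] nkN; first by apply: casoratian0_sign; lia.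
have {}IH : 0 < \prod_(j < k) (-1) ^+ j * casoratian n by apply: IH; lia.
have On : casoratian n != 0 by move: IH; rewrite lt0r mulf_eq0 negb_or => /andP[/andP[]].
have := casoratian_step (ltnW nkN) w0 On.
rewrite -(pmulr_rgt0 _ IH) mulrA; set P := \prod_(j < k) _ => H.
have On2 : 0 < casoratian n ^+ 2 by rewrite exprn_even_gt0.
by rewrite -(pmulr_rgt0 _ On2); move: H; congr (0 < _); ring.
Qed.

End Christoffel.

(** * From Krawtchouk to Hermite polynomials *)

(* Rescaled Krawtchouk polynomials with [c = sqrt (2 / N)], extended to all [c];
   the Hermite polynomials are obtained for [c = 0]. *)
Fixpoint dhermite_pair (S : comNzRingType) (c : S) (n : nat) : {poly S} * {poly S} :=
  if n is m.+1 then
    let: (p, q) := dhermite_pair c m in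
    (q, 2%:R * 'X * q - (m.+1%:R * (2%:R - m%:R * c ^+ 2))%:P * p)
  else (1, 2%:R * 'X).

Definition dhermite (S : comNzRingType) (c : S) (n : nat) : {poly S} :=
  (dhermite_pair c n).1.

Lemma dhermite0 (S : comNzRingType) (c : S) : dhermite c 0 = 1.
Proof. by []. Qed.

Lemma dhermite1 (S : comNzRingType) (c : S) : dhermite c 1 = 2%:R * 'X.
Proof. by []. Qed.

Lemma dhermiteSS (S : comNzRingType) (c : S) n : dhermite c n.+2 =
  2%:R * 'X * dhermite c n.+1 - (n.+1%:R * (2%:R - n%:R * c ^+ 2))%:P * dhermite c n.
Proof. by rewrite /dhermite /=; case: dhermite_pair. Qed.

Lemma nat_ind2 (P : nat -> Prop) :
  P 0 -> P 1 -> (forall n, P n -> P n.+1 -> P n.+2) -> forall n, P n.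
Proof.
by move=> P0 P1 PS n; suff [] : P n /\ P n.+1 by []; elim: n => // n [? ?]; split; auto.
Qed.

Lemma map_dhermite (S T : comNzRingType) (f : {rmorphism S -> T}) (c : S) n :
  map_poly f (dhermite c n) = dhermite (f c) n.
Proof.
elim/nat_ind2: n => [||n IH0 IH1].
- by rewrite !dhermite0 rmorph1.
- by rewrite !dhermite1 rmorphM rmorph_nat /= map_polyX.
rewrite !dhermiteSS rmorphB !rmorphM rmorph_nat /= map_polyX IH0 IH1 !map_polyC /=.
by rewrite rmorphB rmorphM rmorphXn /= !rmorph_nat.
Qed.

(** Since [2 - n c^2 = c^2 (N - n)], the factor [c^n N^_n] turns the Krawtchouk recurrence into that
    of [dhermite]. *)
Lemma dhermite_kraw (R : realFieldType) (N x n : nat) (c : R) :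
  c ^+ 2 * N%:R = 2%:R -> (x <= N)%N ->
  (dhermite c n).[c * (N%:R - 2%:R * x%:R) / 2%:R] =
    c ^+ n * (N ^_ n)%:R * kraw R N n x.
Proof.
move=> cN xN; set y := _ / _.
have yE : 2%:R * y = c * (N%:R - 2%:R * x%:R) by rewrite /y; field.
have k0 : kraw R N 0 x = 1.
  rewrite /kraw big_ord_recl big1 => [|j _].
    by rewrite /kraw_coef !bin0 expr0 invr1 !mulr1 addr0.
  by rewrite /kraw_coef bin0n mulr0 !mul0r.
have ffS m : (N ^_ m.+1)%:R = (N ^_ m)%:R * (N%:R - m%:R) :> R.
  rewrite ffactnSr natrM; have [mN|Nm] := leqP m N; first by rewrite natrB.
  by rewrite ffact_small // !mul0r.
elim/nat_ind2: n => [||n IH0 IH1].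
- by rewrite dhermite0 hornerC k0 expr0 ffactn0 !mulr1.
- rewrite dhermite1 hornerM hornerX -polyC_natr hornerC yE ffactn1 expr1 -mulrA; congr (_ * _).
  by have := @kraw_rec R N 0 x xN; rewrite k0 subr0 mul0r subr0 mulr1 => ->.
rewrite dhermiteSS hornerD hornerN !hornerM hornerX -polyC_natr !hornerC yE IH0 IH1.
have -> : 2%:R - n%:R * c ^+ 2 = c ^+ 2 * (N%:R - n%:R) by rewrite -cN; ring.
have := @kraw_rec R N n.+1 x xN => /= K.
transitivity (c ^+ n.+2 * (N ^_ n.+1)%:R * ((N%:R - n.+1%:R) * kraw R N n.+2 x)).
  by rewrite K ffS !exprS; ring.
by rewrite [(N ^_ n.+2)%:R]ffS; ring.
Qed.

(** The explicit sum satisfies the three-term recurrence at [c = 0]; on coefficients this is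
    [eS]. *)
Lemma hermite_dhermite (R : realType) n : hermite R n = dhermite 0 n.
Proof.
pose Y : {poly R} := 2%:R *: 'X.
(* Coefficients are extended by zero so that sums of different degrees share a common length [K]. *)
pose e n j : R := if (2 * j <= n)%N then n`!%:R * ((-1) ^+ j / (j`!%:R * (n - 2 * j)`!%:R)) else 0.
pose P K n : {poly R} := \sum_(j < K) e n j *: Y ^+ (n - 2 * j).
have eP K m : (m./2 < K)%N -> hermite R m = P K m.
  move=> mK; rewrite /P -(big_mkord xpredT (fun j => e m j *: Y ^+ (m - 2 * j))).
  rewrite (big_cat_nat _ (n := m./2.+1)) //= [X in _ + X]big1_seq ?addr0; last first.
    move=> j; rewrite mem_index_iota => /andP[_ /andP[jm _]].
    by rewrite /e ifF ?scale0r //; lia.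
  rewrite big_mkord /hermite scaler_sumr; apply: eq_bigr => j _.
  by rewrite scalerA /e ifT //; have := ltn_ord j; lia.
have fact_neq0 m : (m`!%:R : R) != 0 by rewrite pnatr_eq0 -lt0n fact_gt0.
have S0 m : (m.+1%:R : R) != 0 by rewrite pnatr_eq0.
have e0 m : e m 0%N = 1 by rewrite /e muln0 leq0n subn0 fact0 expr0 !mul1r divff.
have eS m j : e m.+2 j.+1 = e m.+1 j.+1 - 2%:R * m.+1%:R * e m j.
  rewrite /e; have -> : (2 * j.+1 <= m.+2)%N = (2 * j <= m)%N by lia.
  have [jm|jm] := leqP (2 * j) m; last by rewrite ifF ?mulr0 ?subr0 //; lia.
  have -> : (m.+2 - 2 * j.+1 = m - 2 * j)%N by lia.
  rewrite !factS !natrM exprS.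
  have mE : (m = 2 * j + (m - 2 * j))%N by lia.
  case: (m - 2 * j)%N mE => [|l] mE.
    have -> : m.+2%:R = 2%:R * j.+1%:R :> R by rewrite -natrM; congr (_%:R); lia.
    rewrite ifF ?factS; last by lia.
    move: (S0 j) (fact_neq0 j) (fact_neq0 0%N); rewrite ?fact0.
    move: (j.+1%:R : R) (j`!%:R : R) (m.+1%:R : R) (m`!%:R : R) ((-1) ^+ j : R).
    by move=> a b d f g a0 b0 _; field; rewrite a0 b0.
  have -> : m.+2%:R = 2%:R * j.+1%:R + l.+1%:R :> R.
    by rewrite -natrM -natrD; congr (_%:R); lia.
  rewrite ifT; last by lia.
  have -> : (m.+1 - 2 * j.+1 = l)%N by lia.
  rewrite factS natrM.
  move: (S0 j) (S0 l) (fact_neq0 j) (fact_neq0 l).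
  move: (j.+1%:R : R) (l.+1%:R : R) (j`!%:R : R) (l`!%:R : R).
  move: (m.+1%:R : R) (m`!%:R : R) ((-1) ^+ j : R).
  by move=> f g u a b c d a0 b0 c0 d0; field; rewrite a0 b0 c0 d0.
have HSS m : hermite R m.+2 = 2%:R * 'X * hermite R m.+1 - (2%:R * m.+1%:R)%:P * hermite R m.
  pose K := m.+2.
  rewrite (eP K.+1 m.+2) ?(eP K.+1 m.+1) ?(eP K m); try by rewrite /K; lia.
  rewrite /P mulr_sumr mulr_sumr !(big_ord_recl K) /= !e0 !scale1r !muln0 !subn0.
  rewrite -addrA -sumrB; congr (_ + _).
    by rewrite exprS /Y -mul_polyC polyC_natr.
  apply: eq_bigr => j _; rewrite /bump /= add1n eS scalerBl; congr (_ - _).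
    have [jm|jm] := leqP (2 * j.+1) m.+1; last first.
      by rewrite /e ifF ?scale0r ?mulr0 //; lia.
    have -> : (m.+2 - 2 * j.+1 = (m.+1 - 2 * j.+1).+1)%N by lia.
    by rewrite exprS /Y -!mul_polyC polyC_natr; ring.
  have -> : (m.+2 - 2 * j.+1 = m - 2 * j)%N by lia.
  by rewrite -!mul_polyC polyCM; ring.
elim/nat_ind2: n => [||n IH0 IH1].
- rewrite dhermite0 (eP 1%N) // /P big_ord_recl big_ord0 e0 scale1r addr0.
  by rewrite subn0 expr0.
- rewrite dhermite1 (eP 1%N) // /P big_ord_recl big_ord0 e0 scale1r addr0.
  by rewrite subn0 expr1 /Y -mul_polyC polyC_natr.
by rewrite HSS dhermiteSS IH0 IH1 expr0n mulr0 subr0 [_ * 2%:R]mulrC.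
Qed.

(** * The Hermite differential equation *)

Section HermiteODE.
Variable R : realType.

Lemma deriv_natr n : (n%:R : {poly R})^`() = 0.
Proof. by rewrite -polyC_natr derivC. Qed.

Lemma dhermite0SS n : dhermite 0 n.+2 =
  2%:R * 'X * dhermite 0 n.+1 - 2%:R * n.+1%:R * dhermite 0 n :> {poly R}.
Proof. by rewrite dhermiteSS expr0n mulr0 subr0 polyCM !polyC_natr [2%:R * n.+1%:R]mulrC. Qed.

Lemma deriv_hermite n : (hermite R n.+1)^`() = 2%:R * n.+1%:R * hermite R n.
Proof.
rewrite !hermite_dhermite; elim/nat_ind2: n => [||n IH0 IH1].
- by rewrite dhermite1 dhermite0 derivM derivX deriv_natr; ring.
- rewrite dhermite0SS dhermite1 dhermite0.
  by rewrite !(deriv_natr, derivM, derivB, derivX, derivC); ring.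
rewrite dhermite0SS derivB !derivM !deriv_natr derivX IH1 IH0 [dhermite 0 n.+2]dhermite0SS.
by rewrite -[n.+3%:R]natr1 -[n.+2%:R]natr1; ring.
Qed.

(** Differentiate [H_(n+1) = 2 x H_n - H_n'] and compare with [H_(n+1)' = 2 (n + 1) H_n]. *)
Lemma hermite_ode n :
  (hermite R n)^`()^`() = 2%:R * 'X * (hermite R n)^`() - 2%:R * n%:R * hermite R n.
Proof.
have HS m : hermite R m.+1 = 2%:R * 'X * hermite R m - (hermite R m)^`().
  case: m => [|m]; first by rewrite !hermite_dhermite dhermite1 dhermite0 derivC mulr1 subr0.
  by rewrite deriv_hermite !hermite_dhermite dhermite0SS.
have := deriv_hermite n; rewrite HS derivB !derivM deriv_natr derivX => E.
transitivity (2%:R * hermite R n + 2%:R * 'X * (hermite R n)^`() - 2%:R * n.+1%:R * hermite R n).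
  by rewrite -E; ring.
by rewrite -[n.+1%:R]natr1; ring.
Qed.

Lemma hermite_neq0 n : hermite R n != 0.
Proof.
elim: n => [|n IH]; first by rewrite hermite_dhermite oner_eq0.
apply: contra IH => /eqP H; have := deriv_hermite n; rewrite H derivC => /esym/eqP.
by rewrite -!polyC_natr -polyCM mulf_eq0 polyC_eq0 mulf_eq0 !pnatr_eq0.
Qed.
End HermiteODE.

(** * Divided differences as deformations of derivatives *)

Section DividedDifference.
Variables (S : comNzRingType) (a : S).

(** [d.1] is [(p(X + a) - p) / a], built without division so that any [a] is allowed; [d.2] records
    that it agrees with [p'] modulo [a]. *)
Lemma ddiff_subproof (p : {poly S}) : {d : {poly S} * {poly S} |
  p \Po ('X + a%:P) = p + a *: d.1 /\ d.1 = p^`() + a *: d.2}.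
Proof.
elim/poly_ind: p => [|p c [[d e] /= [pE dE]]].
  by exists (0, 0); rewrite /= comp_poly0 derivC !scaler0 !addr0.
exists (p + d * 'X + a *: d, d + e * 'X); split => /=.
  rewrite comp_polyD comp_polyM comp_polyX comp_polyC pE -!mul_polyC; ring.
by rewrite derivD derivM derivX derivC {1}dE -!mul_polyC; ring.
Qed.

Definition ddiff (p : {poly S}) : {poly S} := (sval (ddiff_subproof p)).1.

Lemma ddiffE p : p \Po ('X + a%:P) = p + a *: ddiff p.
Proof. by rewrite /ddiff; case: ddiff_subproof => d []. Qed.

Lemma map_ddiff (T : comNzRingType) (f : {rmorphism S -> T}) p : f a = 0 ->
  map_poly f (ddiff p) = (map_poly f p)^`().
Proof.
rewrite /ddiff; case: ddiff_subproof => d /= [_ ->] fa0.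
by rewrite rmorphD /= map_polyZ /= fa0 scale0r addr0 deriv_map.
Qed.

(** Newton's forward formula: the shift by [a] is [1 + a ddiff], and its [j]th power is expanded by
    the binomial theorem. *)
Lemma ddiff_newton k j (p : {poly S}) : (j < k)%N ->
  p \Po ('X + (j%:R * a)%:P) = \sum_(m < k) ('C(j, m)%:R * a ^+ m) *: iter m ddiff p.
Proof.
elim: j => [|j IH] jk.
  case: k jk => // k _; rewrite mul0r addr0 comp_polyXr big_ord_recl big1 => [|m _].
    by rewrite addr0 bin0 expr0 mulr1 scale1r.
  by rewrite bin0n mul0r scale0r.
have -> : 'X + (j.+1%:R * a)%:P = ('X + (j%:R * a)%:P) \Po ('X + a%:P) :> {poly S}.
  rewrite comp_polyD comp_polyX comp_polyC -[j.+1%:R]natr1 mulrDl mul1r polyCD; ring.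
rewrite comp_polyA IH ?(ltnW jk) // raddf_sum /=.
rewrite (eq_bigr (fun m : 'I_k => ('C(j, m)%:R * a ^+ m) *: iter m ddiff p +
   ('C(j, m)%:R * a ^+ m.+1) *: iter m.+1 ddiff p)); last first.
  by move=> m _; rewrite comp_polyZ ddiffE scalerDr scalerA -mulrA -exprSr.
rewrite big_split /=; case: k jk {IH} => // k jk.
rewrite [X in _ + X]big_ord_recr /= [X in _ + (_ + X)](_ : _ = 0); last first.
  by rewrite bin_small ?mul0r ?scale0r.
rewrite addr0 !(big_ord_recl k) /= !bin0 -addrA -big_split /=; congr (_ + _).
apply: eq_bigr => m _; rewrite /bump /= add1n binS natrD mulrDl scalerDl.
by rewrite addrC.
Qed.

(** By Newton's formula the matrix of shifts is that of divided differences times [diag(a^m)] times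
    a unitriangular matrix of binomials. *)
Lemma natdet_shift k (p : nat -> {poly S}) :
  natdet k (fun i j => p i \Po ('X + (j%:R * a)%:P)) =
  (\prod_(m < k) a ^+ m)%:P * natdet k (fun i m => iter m ddiff (p i)).
Proof.
pose D := \matrix_(i < k, m < k) iter m ddiff (p i).
pose E : 'M[{poly S}]_k := diag_mx (\row_(m < k) (a ^+ m)%:P).
pose B : 'M[{poly S}]_k := \matrix_(m, j) 'C(j, m)%:R.
have detB : \det B = 1.
  rewrite -det_tr det_trig; last first.
    by apply/is_trig_mxP => i j ij; rewrite !mxE bin_small.
  by rewrite big1 // => i _; rewrite !mxE binn.
have detE : \det E = (\prod_(m < k) a ^+ m)%:P.
  by rewrite det_diag rmorph_prod; apply: eq_bigr => m _; rewrite mxE.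
rewrite -detE mulrC -[X in X * _]/(\det D) -[LHS]mulr1.
transitivity (\det (D *m E *m B)); last by rewrite !det_mulmx detB mulr1.
rewrite mulr1; congr (\det _); apply/matrixP => i j; rewrite mxE.
rewrite (@ddiff_newton k) // mxE; apply: eq_bigr => m _.
by rewrite mul_mx_diag !mxE -mul_polyC polyCM polyC_natr; ring.
Qed.
End DividedDifference.

Lemma natdet_scale (S : comNzRingType) k (u : nat -> S) (b : nat -> nat -> S) :
  natdet k (fun i j => u i * b i j) = (\prod_(i < k) u i) * natdet k b.
Proof.
rewrite -[X in X * _](_ : \det (diag_mx (\row_(i < k) u i)) = _); last first.
  by rewrite det_diag; apply: eq_bigr => i _; rewrite mxE.
by rewrite -det_mulmx; congr (\det _); apply/matrixP => i j; rewrite mul_diag_mx !mxE.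
Qed.

Lemma rmorph_natdet (S T : comNzRingType) (f : {rmorphism S -> T}) k (b : nat -> nat -> S) :
  f (natdet k b) = natdet k (fun i j => f (b i j)).
Proof.
by rewrite /natdet -det_map_mx; congr (\det _); apply/matrixP => i j; rewrite !mxE.
Qed.

(** * Nonnegativity of Wronskians by passage to the limit *)

Section Limit.
Variable R : realType.
Variable s : seq nat.

Local Notation W := (wronskian [seq hermite R n | n <- s]).
Let k := size s.

(* [g] is obtained by dividing the determinant, viewed as a polynomial in [t], by
   its obvious power of [t]. *)
Lemma wronskian_deformation (r : R) : exists g : {poly R},
  g.[0] = W.[r] /\ forall t : R, (\prod_(m < k) (- t) ^+ m) * g.[t] =
    natdet k (fun i j => (dhermite t (nth 0%N s i)).[r - j%:R * t]).
Proof.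
(* The parameter becomes an indeterminate, specialized by [ev t]. The shift [- c] puts column [j] at
   [r - j t], and at [t = 0] divided differences become derivatives. *)
pose c : {poly R} := 'X.
pose P i := dhermite c (nth 0%N s i).
pose G := natdet k (fun i m => iter m (ddiff (- c)) (P i)).
pose ev (t : R) : {rmorphism {poly R} -> R} := horner_eval t.
have evc t : ev t c = t by rewrite /ev /= /horner_eval /c hornerX.
have evr t (Q : {poly {poly R}}) : ev t Q.[r%:P] = (map_poly (ev t) Q).[r].
  by rewrite -[in RHS](_ : ev t r%:P = r) ?horner_map // /ev /= /horner_eval hornerC.
exists G.[r%:P]; split.
  transitivity (ev 0 G.[r%:P]); first by [].
  rewrite evr; congr (_.[_]); rewrite /G rmorph_natdet /wronskian size_map.
  apply: eq_natdet => i m ik _; rewrite (nth_map 0%N) // hermite_dhermite.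
  have -> : dhermite 0 (nth 0%N s i) = map_poly (ev 0) (P i).
    by rewrite /P map_dhermite evc.
  elim: m => [|m IH] //=; rewrite map_ddiff ?IH -?derivnS //.
  by rewrite rmorphN evc oppr0.
move=> t; transitivity (ev t ((\prod_(m < k) (- c) ^+ m)%:P * G).[r%:P]).
  rewrite hornerM hornerC rmorphM rmorph_prod; congr (_ * _).
  by apply: eq_bigr => m _; rewrite rmorphXn rmorphN evc.
rewrite /G -natdet_shift evr rmorph_natdet -[LHS]/(horner_eval r _) rmorph_natdet.
apply: eq_natdet => i j _ _.
transitivity (map_poly (ev t) (P i \Po ('X + (j%:R * - c)%:P))).[r]; first by [].
rewrite map_comp_poly horner_comp.
rewrite /P map_dhermite evc rmorphD /= map_polyX map_polyC /= !hornerE.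
by rewrite rmorphM rmorphN evc rmorph_nat; congr (_.[_]); ring.
Qed.

Hypothesis s_sorted : sorted ltn s.
Hypothesis s_weight : forall x : nat, 0 <= \prod_(f <- s) (x%:R - f%:R) :> R.

(* Taking [N = 2 * M ^ 2] keeps the scale [t = sqrt (2 / N)] rational, so that a
   fixed rational [r] is a point of the lattice for arbitrarily large [M]. *)
Lemma deformation_gt0 (r : R) (g : {poly R}) (M x0 : nat) : (0 < M)%N ->
  (forall t : R, (\prod_(m < k) (- t) ^+ m) * g.[t] =
    natdet k (fun i j => (dhermite t (nth 0%N s i)).[r - j%:R * t])) ->
  (forall f, f \in s -> (f <= 2 * M ^ 2)%N) ->
  (x0 + k <= 2 * M ^ 2)%N -> r * M%:R = (M ^ 2)%:R - x0%:R ->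
  0 < g.[M%:R^-1].
Proof.
move=> M0 /(_ M%:R^-1); set t : R := M%:R^-1; set N := (2 * M ^ 2)%N => gE s_le x0k rM.
have MR0 : (M%:R : R) != 0 by rewrite pnatr_eq0 -lt0n.
have t0 : 0 < t by rewrite invr_gt0 ltr0n.
have tN : t ^+ 2 * N%:R = 2%:R by rewrite /t /N natrM natrX; field.
have := casoratian_sign s_sorted x0k (fun x _ => s_weight x).
have -> : casoratian R N s x0 =
    (\prod_(i < k) (t ^+ nth 0%N s i * (N ^_ nth 0%N s i)%:R))^-1 *
    ((\prod_(m < k) (- t) ^+ m) * g.[t]).
  rewrite gE (_ : natdet _ _ = (\prod_(i < k) (t ^+ nth 0%N s i * (N ^_ nth 0%N s i)%:R))
     * casoratian R N s x0).
    rewrite mulKf //; apply/prodf_neq0 => i _; rewrite mulf_neq0 ?expf_neq0 ?gt_eqF //.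
    by rewrite ltr0n ffact_gt0 s_le // mem_nth.
  rewrite /casoratian -(natdet_scale _ (fun i => t ^+ nth 0%N s i * (N ^_ nth 0%N s i)%:R)).
  (* For [t = 1 / M] and [N = 2 M^2], the lattice point [x0 + j] corresponds to the argument
     [r - j t]. *)
  apply: eq_natdet => i j ik jk; rewrite kraw_sym -dhermite_kraw //; last by lia.
  congr (_.[_]); rewrite /N natrM natrD.
  have -> : r = ((M ^ 2)%:R - x0%:R) / M%:R by rewrite -rM mulfK.
  by rewrite /t; field.
set K := (\prod_(i < k) _)^-1; rewrite mulrCA.
have K0 : 0 < K.
  rewrite invr_gt0; apply: prodr_gt0 => i _; rewrite mulr_gt0 ?exprn_gt0 //.
  by rewrite ltr0n ffact_gt0 s_le // mem_nth.
(* The sign of the Casoratian cancels that of the product of the [(- t)^m]. *)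
rewrite pmulr_rgt0 // mulrA -big_split /= pmulr_rgt0 //.
by apply: prodr_gt0 => m _; rewrite -exprMn mulN1r opprK exprn_gt0.
Qed.

(** If the value [g(0)] were negative, [g(1/M)] would be negative for large [M], against
    [deformation_gt0]. *)
Lemma wronskian_rat_ge0 (z : int) (q : nat) : (0 < q)%N -> 0 <= W.[z%:~R / q%:R].
Proof.
move=> q0; set r := _ / _; have [g [g0 gE]] := wronskian_deformation r.
rewrite -g0 leNgt; apply/negP => g_lt0.
have [d d0 dP] := poly_cont 0 g (e := - g.[0]) ltac:(lra).
pose b := (\max_(f <- s) f)%N.
(* The summands ensure in turn [1/M < d], [f <= N] for [f] in [s], and, by means of [k] and [|z|],
   that [x0, ..., x0 + k] lie in [{0, ..., N}]. The factor [q] of [M] makes [r M] an integer. *)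
pose m := ((Num.truncn d^-1) + b + k + `|z|%N + 1)%N.
pose M := (q * m)%N.
have mM : (m <= M)%N by rewrite /M leq_pmull.
have m0 : (0 < m)%N by rewrite /m addn1.
have M0 : (0 < M)%N by rewrite /M muln_gt0 q0.
have kM : (k + 1 <= M)%N by lia.
have MM : (M * (k + `|z| + 1) <= M ^ 2)%N by rewrite -mulnn leq_mul2l; lia.
have zm : (`|z| * m <= M * `|z|)%N by rewrite mulnC leq_mul2r mM orbT.
pose x0 := absz ((M ^ 2)%:Z - z * m%:Z)%R.
have x0E : x0%:Z = (M ^ 2)%:Z - z * m%:Z.
  rewrite /x0 gez0_abs // subr_ge0.
  have : (absz (z * m%:Z)%R <= M ^ 2)%N by rewrite abszM absz_nat; lia.
  lia.
have x0k : (x0 + k <= 2 * M ^ 2)%N.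
  have : (x0%:Z <= (M ^ 2)%:Z + (`|z| * m)%:Z).
    rewrite x0E lerD2l PoszM -mulNr ler_wpM2r //. lia.
  have : (k <= M * k)%N by rewrite leq_pmull.
  lia.
have rM : r * M%:R = (M ^ 2)%:R - x0%:R.
  have -> : (x0%:R : R) = x0%:Z%:~R by [].
  rewrite x0E intrB intrM -!pmulrn /r /M natrX natrM.
  have q0' : (q%:R : R) != 0 by rewrite pnatr_eq0 -lt0n.
  by field.
have s_le f : f \in s -> (f <= 2 * M ^ 2)%N.
  move=> fs; have : (f <= b)%N by apply: (leq_bigmax_seq f fs).
  have : (M <= M ^ 2)%N by rewrite -mulnn leq_pmulr.
  lia.
have gpos := deformation_gt0 M0 gE s_le x0k rM.
have : `|M%:R^-1 - 0 : R| < d.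
  rewrite subr0 ger0_norm ?invr_ge0 ?ler0n // invf_plt ?posrE ?ltr0n //.
  apply: (lt_le_trans (truncnS_gt _)); rewrite ler_nat.
  by apply: leq_trans mM; rewrite /m -!addnA -[X in (X < _)%N]addn0 ltn_add2l !addnA addn1.
by move/dP; rewrite ltr_distl; lra.
Qed.

Lemma wronskian_ge0 (x : R) : 0 <= W.[x].
Proof.
rewrite leNgt; apply/negP => W_lt0.
have [d d0 dP] := poly_cont x W (e := - W.[x]) ltac:(lra).
have [|y] := @rat_in_itvoo R (x - d) (x + d); first by lra.
rewrite in_itv /= => yd.
have := @wronskian_rat_ge0 (numq y) `|denq y|%N; rewrite absz_gt0 denq_neq0.
have -> : (numq y)%:~R / `|denq y|%:R = ratr y :> R.
  by rewrite /ratr; congr (_ / _); rewrite natr_absz ger0_norm.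
move=> /(_ isT); have : `|ratr y - x| < d by rewrite ltr_distl.
by move/dP; rewrite ltr_distl; lra.
Qed.
End Limit.

(** * Admissible sets *)

(** Admissibility in a form suited to induction: runs of even length are cut into pairs
    [a, a + 1]. *)
Fixpoint paired (s : seq nat) : bool :=
  match s with
  | [::] => true
  | [:: _] => false
  | [:: a, b & s'] => (b == a.+1) && paired s'
  end.

Lemma seq_pair_ind (T : Type) (P : seq T -> Prop) :
  P [::] -> (forall a, P [:: a]) -> (forall a b s, P s -> P [:: a, b & s]) ->
  forall s, P s.
Proof.
move=> P0 P1 PS s; suff [] : P s /\ forall a, P (a :: s) by [].
by elim: s => // a s [? ?]; split; auto.
Qed.

Lemma paired_cat s t : paired s -> paired t -> paired (s ++ t).
Proof. by elim/seq_pair_ind: s => //= a b s IH /andP[-> /IH] h /h. Qed.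

Lemma paired_iota m l : ~~ odd l -> paired (iota m l).
Proof.
move=> ol; rewrite -(even_halfK ol); elim: l./2 m => // n IH m.
by rewrite doubleS /= eqxx IH.
Qed.

Lemma paired_rcons s : paired s -> s = [::] \/
  exists s' n, s = rcons (rcons s' n) n.+1 /\ paired s'.
Proof.
elim/seq_pair_ind: s => //= [|a b s IH]; first by left.
case/andP => /eqP -> /IH [->|[s' [n [-> ps']]]]; right.
  by exists [::], a.
by exists [:: a, a.+1 & s'], n; rewrite /= eqxx.
Qed.

(** * Pairing and the signs of the node products *)

Section Sign.
Variable R : rcfType.

(** No integer lies strictly between [a] and [a + 1], so each pair contributes a nonnegative
    factor. *)
Lemma paired_nodes_ge0 s n : paired s -> 0 <= nodes R s n.
Proof.
rewrite /nodes; elim/seq_pair_ind: s => [|//|a b s IH] /=; first by rewrite big_nil ler01.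
case/andP => /eqP -> /IH {}IH; rewrite !big_cons mulrA mulr_ge0 //.
have [na|an] := leqP n a.
  by rewrite mulr_le0 // subr_le0 ler_nat // leqW.
by rewrite mulr_ge0 // subr_ge0 ler_nat // ltnW.
Qed.

Lemma nodes_sign s n : all (fun f => n < f)%N s -> 0 < (-1) ^+ size s * nodes R s n.
Proof.
rewrite /nodes; elim: s => [_|f s IH] /=; first by rewrite big_nil mul1r ltr01.
case/andP => nf /IH {}IH; rewrite big_cons exprS.
have -> (x y z : R) : -1 * x * (y * z) = - y * (x * z) by ring.
by rewrite mulr_gt0 // opprB subr_gt0 ltr_nat.
Qed.

(** At the first pair [a, b] with a gap take [n = a + 1]: that pair gives a negative factor, and the
    even number of larger elements a positive one. The bound on [n] makes the factors of the
    preceding pairs positive. *)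
Lemma unpaired_nodes_lt0 s : sorted ltn s -> ~~ odd (size s) -> ~~ paired s ->
  exists2 n, (head 0 s < n)%N & nodes R s n < 0.
Proof.
elim/seq_pair_ind: s => //= a b s IH; rewrite negbK => /andP[ab bs] os.
have bs' : all (fun f => b < f)%N s by apply: (order_path_min ltn_trans).
have nodesE n : nodes R [:: a, b & s] n = (n%:R - a%:R) * (n%:R - b%:R) * nodes R s n.
  by rewrite /nodes !big_cons mulrA.
case: eqP => [bE|/eqP nb] /=.
  move=> np; have [|n ns nn] := IH _ os np; first exact: path_sorted bs.
  have bn : (b < n)%N.
    by case: s {IH os bs nodesE} bs' np ns nn => //= c s /andP[bc _] _ cn _; lia.
  exists n; first by lia.
  by rewrite nodesE pmulr_rlt0 // mulr_gt0 // subr_gt0 ltr_nat; lia.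
move=> _; exists a.+1 => //; rewrite nodesE -natr1 addrAC subrr add0r mul1r.
have ns : all (fun f => a.+1 < f)%N s by apply: sub_all bs' => f /=; lia.
have := nodes_sign ns; rewrite -signr_odd (negPf os) expr0 mul1r => ps.
by rewrite natr1 pmulr_llt0 // subr_lt0 ltr_nat; lia.
Qed.

(** Odd length is excluded at [n = 0], which lies below all elements; even length is settled by
    [unpaired_nodes_lt0]. *)
Lemma nodes_ge0_paired s : sorted ltn s -> all (fun f => 0 < f)%N s ->
  (forall n, 0 <= nodes R s n) -> paired s.
Proof.
move=> ss s0 sn; apply: contraT => np; have [os|os] := boolP (odd (size s)).
  have := nodes_sign s0; rewrite -signr_odd os expr1 mulN1r oppr_gt0.
  by rewrite ltNge sn.
by have [n _] := unpaired_nodes_lt0 ss os np; rewrite ltNge sn.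
Qed.
End Sign.

(** * Increasing enumerations and block decompositions *)

Lemma increnum_sorted (F : {fset nat}) : sorted ltn (increnum F).
Proof.
by rewrite ltn_sorted_uniq_leq sort_uniq fset_uniq sort_sorted.
Qed.

Lemma mem_increnum (F : {fset nat}) x : (x \in increnum F) = (x \in F).
Proof. by rewrite mem_sort. Qed.

Lemma size_increnum (F : {fset nat}) : size (increnum F) = #|` F|.
Proof. by rewrite size_sort. Qed.

Lemma sorted_ltn_eq (s t : seq nat) : sorted ltn s -> sorted ltn t -> s =i t -> s = t.
Proof. exact: (irr_sorted_eq ltn_trans ltnn). Qed.

(* The interval [m, m + l) is encoded as the pair [(m, l)]. *)
Definition separated (bs : seq (nat * nat)) : bool :=
  sorted (fun b c => b.1 + b.2 < c.1)%N bs.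

Definition points (bs : seq (nat * nat)) : seq nat :=
  flatten [seq iota b.1 b.2 | b <- bs].

Lemma separated_pairwise bs : separated bs ->
  pairwise (fun b c => b.1 + b.2 < c.1)%N bs.
Proof. by rewrite /separated sorted_pairwise // => b a c /=; lia. Qed.

Lemma points_sorted bs : separated bs -> sorted ltn (points bs).
Proof.
move/separated_pairwise; rewrite sorted_pairwise; last exact: ltn_trans.
rewrite /points; elim: bs => //= b bs IH /andP[bbs /IH {}IH].
rewrite pairwise_cat IH -sorted_pairwise ?iota_ltn_sorted ?andbT //=; last exact: ltn_trans.
apply/allrelP => x y; rewrite mem_iota => /andP[_ xb] /flattenP[_ /mapP[c cbs ->]].
rewrite mem_iota => /andP[cy _]; have := allP bbs _ cbs; lia.
Qed.

(** A new pair [a, a + 1] in front is merged with the first interval if they touch, and otherwise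
    forms an interval of its own. *)
Lemma paired_points s : sorted ltn s -> paired s -> exists bs,
  [/\ s = points bs, separated bs & all (fun b => (0 < b.2)%N && ~~ odd b.2) bs].
Proof.
elim/seq_pair_ind: s => [_ _|//|a b s IH] /=; first by exists [::].
case/andP => _ bs /andP[/eqP bE ps]; subst b.
have [[|[m l] bs'] [sE sep ev]] := IH (path_sorted bs) ps.
  by exists [:: (a, 2)]; rewrite sE.
move: ev => /= /andP[/andP[l0 ol] ev].
have am : (a.+1 < m)%N.
  by move: bs; rewrite sE /points /=; case: l l0 {ol sE sep} => //= l _ /andP[].
have [E|ne] := eqVneq m a.+2.
  exists ((a, l.+2) :: bs'); split; rewrite /= ?negbK ?ol ?ev //.
    by rewrite sE E.
  move: sep; rewrite /separated /=; case: bs' {sE ev} => //= c bs' /andP[lc ->].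
  by rewrite andbT; lia.
exists [:: (a, 2), (m, l) & bs']; split; rewrite /= ?l0 ?ol ?ev ?sE //.
by move: sep; rewrite /separated /= addn2 => ->; rewrite andbT; lia.
Qed.

Lemma increnum_iota m l : increnum [fset x in iota m l]%fset = iota m l.
Proof.
apply: sorted_ltn_eq; [exact: increnum_sorted | exact: iota_ltn_sorted |].
by move=> x; rewrite mem_increnum !inE.
Qed.

Lemma consecutive_fmax Y : Y != fset0 -> consecutive Y ->
  (fmax Y).+1 = (fmin Y + #|` Y|)%N.
Proof.
rewrite -cardfs_gt0 /fmax => Y0 /eqP ->; case: #|` Y| Y0 => // l _.
by rewrite -nth_last size_iota nth_iota /= ?addnS.
Qed.

Lemma mem_bigfcup (Ys : seq {fset nat}) x :
  (x \in \bigcup_(Y <- Ys) Y)%fset = has (fun Y => x \in Y) Ys.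
Proof. by elim: Ys => [|Y Ys IH]; rewrite ?big_nil ?big_cons !inE //= IH. Qed.

(** Both directions encode a block [Y] as the interval [(fmin Y, #|Y|)]; even intervals concatenate
    to a paired list, and [paired_points] gives the converse. *)
Lemma admissible_paired F : admissible F <-> paired (increnum F).
Proof.
split=> [[Ys [[FE _ ne sY] ev]]|pF].
  pose bs := [seq (fmin Y, #|` Y|) | Y <- Ys].
  have -> : increnum F = points bs.
    apply: sorted_ltn_eq; first exact: increnum_sorted.
      apply: points_sorted; rewrite /separated sorted_map.
      elim: Ys ne sY {FE ev bs} => //= Y [//|Z Ys] IH /andP[/andP[Y0 cY] ne] /andP[YZ sY].
      have := IH ne sY; rewrite /= => ->; rewrite andbT.
      (* For an interval [Y], [1 + fmax Y] is the first integer after it, so the two gap conditions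
         coincide. *)
      by rewrite -(consecutive_fmax Y0 cY).
    move=> x; rewrite mem_increnum FE mem_bigfcup /points -map_comp.
    elim: Ys ne {FE sY ev bs} => //= Y Ys IH /andP[/andP[_ /eqP cY] ne].
    by rewrite mem_cat IH // -cY mem_increnum.
  rewrite /points /bs; elim: Ys ev {FE ne sY bs} => //= Y Ys IH /andP[oY ev].
  by rewrite paired_cat ?paired_iota ?IH.
have [bs [FE sep ev]] := paired_points (increnum_sorted F) pF.
pose Y (b : nat * nat) : {fset nat} := [fset x in iota b.1 b.2]%fset.
have Yc b : #|` Y b| = b.2 by rewrite -size_increnum increnum_iota size_iota.
have Ymin b : (0 < b.2)%N -> fmin (Y b) = b.1.
  by rewrite /fmin increnum_iota; case: b.2.
have Y0 b : (Y b != fset0) = (0 < b.2)%N by rewrite -cardfs_gt0 Yc.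
have Ycons b : (0 < b.2)%N -> consecutive (Y b).
  by move=> b0; rewrite /consecutive Yc Ymin // increnum_iota.
exists (map Y bs); split; last first.
  by rewrite all_map; apply: sub_all ev => b /=; rewrite Yc => /andP[].
have ev0 : all (fun b => 0 < b.2)%N bs by apply: sub_all ev => b /= /andP[].
split.
- apply/fsetP => x; rewrite -mem_increnum FE mem_bigfcup has_map /points.
  by elim: (bs) => //= b t IH; rewrite mem_cat IH inE.
- rewrite pairwise_map; apply: sub_pairwise (separated_pairwise sep) => b c /= bc.
  apply/fdisjointP => x; rewrite !inE !mem_iota; lia.
- by rewrite all_map; apply: sub_all ev0 => b /= b0; rewrite Y0 b0 Ycons.
- rewrite sorted_map; move: sep; rewrite /separated.
  elim: bs ev0 {ev FE pF} => //= b [//|c t] IH /andP[b0 /[dup] /andP[c0 _] ev0] /andP[bc st].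
  rewrite /= in IH *; rewrite IH // andbT Ymin //.
  have := consecutive_fmax _ (Ycons _ b0); rewrite Y0 Ymin // Yc => /(_ b0); lia.
Qed.

(** * Real zeros of Hermite Wronskians and the equivalence *)

(** Induction removing the last pair: the shorter Wronskian has no zero, the longer one is
    nonnegative, and [wronskian_ge0_noroot] makes it nonzero. *)
Lemma paired_wronskian_noroot (R : realType) (s : seq nat) :
  sorted ltn s -> paired s -> forall x, ~~ root (wronskian [seq hermite R n | n <- s]) x.
Proof.
have [m] := ubnP (size s); elim: m s => // m IH s sm ss /[dup] ps.
case/paired_rcons => [->|[t [n [sE pt]]]] x.
  by rewrite /= wronskian_nil rootE hornerC oner_eq0.
have st : sorted ltn t.
  by move: ss; rewrite sE -!cats1 => /cat_sorted2[/cat_sorted2[]].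
have tm : (size t < m)%N by move: sm; rewrite sE !size_rcons; lia.
rewrite sE; apply: (wronskian_ge0_noroot (@hermite_neq0 R) (@hermite_ode R)).
- by rewrite -sE; apply: (sorted_uniq ltn_trans ltnn ss).
- exact: IH.
- by rewrite -sE; apply: wronskian_ge0 => // y; apply: paired_nodes_ge0.
Qed.

Lemma wronskian_hermiteE (R : realType) (F : {fset nat}) (x : R) :
  wronskian_hermite F x = (wronskian [seq hermite R n | n <- increnum F]).[x].
Proof.
rewrite /wronskian size_map size_increnum -[RHS]/(horner_eval x _) rmorph_natdet.
rewrite -[LHS]/(natdet _ (fun i j => (hermite R (nth 0%N (increnum F) i))^`(j).[x])).
by apply: eq_natdet => i j ik _; rewrite (nth_map 0%N) // size_increnum.
Qed.

Theorem lemma6p2 (R : realType) (F : {fset nat})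
    (hF : forall n : nat, n \in F -> (0 < n)%N) :
  admissible F <-> (forall x : R, wronskian_hermite F x != 0).
Proof.
have ss := increnum_sorted F; rewrite admissible_paired; split => [pF x|nF].
  by rewrite wronskian_hermiteE -rootE paired_wronskian_noroot.
apply: (@nodes_ge0_paired R) => //.
  by apply/allP => n; rewrite mem_increnum => /hF.
move=> n; apply: (nodes_ge0 (@hermite_neq0 R) (@hermite_ode R)).
  exact: (sorted_uniq ltn_trans ltnn ss).
by move=> x; rewrite rootE -wronskian_hermiteE.
Qed.
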